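(* For each $s<t$ and $p\in[1,+\infty)$, the operator $P_{s,t}:C_b(X)\to C_b(X)$ has a bounded extension $$P_{s,t}^p:L^p(X,\mu_t)\to L^p(X,\mu_s).$$ Analogously, the operator $\overrightarrow{P_{s,t}}:C_b(X;X)\to C_b(X;X)$ has a bounded extension $$\overrightarrow{P_{s,t}^p}:L^p(X,\mu_t;X)\to L^p(X,\mu_s;X).$$ Both these extended operators are contractions. Moreover $$\int_XP_{s,t}^p\varphi\,d\mu_s=\int_X\varphi\,d\mu_t\quad\forall\varphi\in L^p(X,\mu_t),\qquad\int_X\overrightarrow{P_{s,t}^p}\Phi\,d\mu_s=\int_X\Phi\,d\mu_t\quad\forall\Phi\in L^p(X,\mu_t;X).$$ Here $\mu_t:=\mathcal N(0,Q(t,-\infty))$ for $t\in\mathbb R$.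
   Context: $X$ is a separable real Hilbert space with inner product $\langle\cdot,\cdot\rangle_X$ and norm $|\cdot|_X$; $\mathcal L(X)$ is the space of bounded linear operators on $X$. $\{A(t)\}_{t\in\mathbb R}$ is a family of linear operators $A(t):D(A(t))\subseteq X\to X$ generating a strongly continuous evolution operator $\{U(t,s):s\le t\}\subseteq\mathcal L(X)$, i.e. $\partial_tU(t,s)=A(t)U(t,s)$ for $s<t$, $U(t,s)=U(t,r)U(r,s)$ for $s\le r\le t$, $U(\tau,\tau)=I$, and $(t,s)\mapsto U(t,s)x$ is continuous on $\{s\le t\}$ for every $x\in X$. The set $\Omega_U:=\{\omega\in\mathbb R:\exists M>0,\ \|U(t,s)\|_{\mathcal L(X)}\le Me^{\omega(t-s)}\ \forall s\le t\}$ is non-empty and $\omega_0:=\inf\Omega_U<0$. $\{B(t)\}_{t\in\mathbb R}\subseteq\mathcal L(X)$ is bounded in operator norm and $t\mapsto B(t)x$ is measurable for every $x\in X$. For $s\le t$ set $Q(t,s):=\int_s^tU(t,r)B(r)B(r)^*U(t,r)^*\,dr$ and $Q(t,-\infty):=\int_{-\infty}^tU(t,r)B(r)B(r)^*U(t,r)^*\,dr$. Standing assumptions: every $Q(t,s)$ is trace class and $\sup_{s\le t}\mathrm{tr}\,Q(t,s)<+\infty$ for every $t$ (which implies that $Q(t,-\infty)$ is trace class); controllability: $\mathrm{Im}\,U(t,s)\subseteq \mathrm{Im}\,Q(t,s)^{1/2}$ for all $s<t$. $\mathcal N(a,Q)$ denotes the (possibly degenerate) Gaussian measure on $X$ with mean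 $a$ and covariance $Q$. $C_b(X)$ and $C_b(X;X)$ are the spaces of bounded continuous real-valued, respectively $X$-valued, functions on $X$. For $s\le t$, $[P_{s,t}\varphi](x):=\int_X\varphi(U(t,s)x+y)\,\mathcal N(0,Q(t,s))(dy)$ for $\varphi\in C_b(X)$ and $[\overrightarrow{P_{s,t}}\Phi](x):=\int_X\Phi(U(t,s)x+y)\,\mathcal N(0,Q(t,s))(dy)$ for $\Phi\in C_b(X;X)$; vector-valued integrals are Bochner integrals. A contraction is a bounded operator of norm at most $1$. *)

(* Defs.v *)
From HB Require Import structures.
From mathcomp Require Import all_boot all_order all_algebra.
From mathcomp Require Import sesquilinear.
From mathcomp Require Import all_classical all_reals all_analysis.

Set Implicit Arguments.
Unset Strict Implicit.
Unset Printing Implicit Defensive.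

Import Order.TTheory GRing.Theory Num.Theory.
Import numFieldNormedType.Exports.

Local Open Scope classical_set_scope.
Local Open Scope ring_scope.

Definition separable (T : topologicalType) : Prop :=
  exists2 S : set T, countable S & dense S.

(* [borel X] is the carrier of X, endowed with the Borel sigma-algebra. *)
Notation borel X := (g_sigma_algebraType (@open X)).

Section Bochner.
Context d (T : measurableType d) (R : realType) (V : normedModType R).
Variable mu : {measure set T -> \bar R}.

(* The function \sum_(i < sf_size) \1_(sf_set i) sf_val i. *)
Record simple_function := SimpleFunction {
  sf_size : nat;
  sf_set : nat -> set T;
  sf_val : nat -> V;
  sf_measurable : forall i, measurable (sf_set i);
  sf_finite : forall i, (mu (sf_set i) < +oo)%E }.

Definition sf_fun (g : simple_function) (x : T) : V :=
  \sum_(i < sf_size g) \1_(sf_set g i) x *: sf_val g i.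

Definition sf_integral (g : simple_function) : V :=
  \sum_(i < sf_size g) fine (mu (sf_set g i)) *: sf_val g i.

Definition bochner_approx (f : T -> V) (g : nat -> simple_function) : Prop :=
  {ae mu, forall x, sf_fun (g n) x @[n --> \oo] --> f x} /\
  (\int[mu]_x (`|f x - sf_fun (g n) x|)%:E)%E @[n --> \oo] --> (0 : \bar R)%E.

(* The value is 0 when f is not Bochner integrable. *)
Definition bochner (f : T -> V) : V :=
  xget 0 [set v | exists2 g : nat -> simple_function, bochner_approx f g &
                    sf_integral (g n) @[n --> \oo] --> v].

Definition bochner_on (D : set T) (f : T -> V) : V :=
  bochner (fun x => \1_D x *: f x).

End Bochner.

Section Operators.
Context (R : realType) (X : completeNormedModType R).
Implicit Types S T : X -> X.

Definition opnorm T : \bar R :=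
  ereal_sup [set (`|T x|)%:E | x in [set x : X | `|x| <= 1]].

Definition bounded_operator T : Prop := linear T /\ (opnorm T < +oo)%E.

Variable ip : {dot X for @idfun R}.

Definition adjoint T : X -> X :=
  fun y => xget 0 [set z | forall x, ip (T x) y = ip x z].

Definition nonneg_operator T : Prop :=
  [/\ bounded_operator T, forall x y, ip (T x) y = ip x (T y)
    & forall x, 0 <= ip (T x) x].

Definition sqrt_operator T : X -> X :=
  xget (fun=> 0) [set S | nonneg_operator S /\ forall x, S (S x) = T x].

Definition abs_operator T : X -> X := sqrt_operator (adjoint T \o T).

Definition orthonormal_basis (E : set X) : Prop :=
  (forall e f, E e -> E f -> ip e f = (e == f)%:R) /\
  (forall x, (forall e, E e -> ip x e = 0) -> x = 0).

(* One orthonormal basis, fixed once and for all; trace class operators and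
   their traces do not depend on this choice. *)
Definition basis : set X := xget set0 orthonormal_basis.

Definition trace_class T : Prop :=
  bounded_operator T /\
  (\esum_(e in basis) (ip (abs_operator T e) e)%:E < +oo)%E.

Definition trace T : \bar R :=
  (\esum_(e in basis) (Num.max (ip (T e) e) 0)%:E -
   \esum_(e in basis) (Num.max (- ip (T e) e) 0)%:E)%E.

(* The Gaussian law on the real line with mean m and variance v >= 0. The
   degenerate case is treated apart because [normal_prob m 0] is not a Dirac
   mass. *)
Definition real_gaussian (m v : R) (A : set R) : \bar R :=
  if 0 < v then normal_prob m (Num.sqrt v) A else \d_m A.

(* m is N(a, Q): every continuous linear functional <., h> is, under m, a
   Gaussian variable with mean <a, h> and variance <Q h, h>. *)
Definition is_gaussian (m : probability (borel X) R) (a : X) (Q : X -> X)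
    : Prop :=
  forall (h : X) (A : set R), measurable A ->
    m [set x : X | A (ip x h)] = real_gaussian (ip a h) (ip (Q h) h) A.

End Operators.

Section EvolutionOperators.
Context (R : realType) (X : completeNormedModType R).

(* A t is a linear operator with domain D t; U t s is only meaningful for
   s <= t. *)
Record evolution_operator (D : R -> set X) (A : R -> X -> X)
    (U : R -> R -> X -> X) : Prop := {
  evo_dom0 : forall t, D t 0;
  evo_domP : forall t a x y, D t x -> D t y -> D t (a *: x + y);
  evo_gen_linear : forall t a x y, D t x -> D t y ->
    A t (a *: x + y) = a *: A t x + A t y;
  evo_bounded : forall s t : R, s <= t -> bounded_operator (U t s);
  evo_range : forall (s t : R) x, s < t -> D t (U t s x);
  evo_derive : forall (s t : R) x, s < t ->
    is_derive t 1 (fun r : R => U r s x) (A t (U t s x));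
  evo_comp : forall (s r t : R) x, s <= r -> r <= t -> U t s x = U t r (U r s x);
  evo_id : forall t x, U t t x = x;
  evo_continuous : forall x,
    {within [set ts : R * R | ts.2 <= ts.1],
      continuous (fun ts : R * R => U ts.1 ts.2 x)} }.

Definition growth_exponents (U : R -> R -> X -> X) : set R :=
  [set w | exists2 M : R, 0 < M &
     forall s t : R, s <= t -> (opnorm (U t s) <= (M * expR (w * (t - s)))%:E)%E].

Definition omega0 (U : R -> R -> X -> X) : \bar R :=
  ereal_inf [set w%:E | w in growth_exponents U].

Variable ip : {dot X for @idfun R}.

Definition covariance_on (U : R -> R -> X -> X) (B : R -> X -> X)
    (t : R) (I : set R) (x : X) : X :=
  bochner_on (@lebesgue_measure R) I
    (fun r => U t r (B r (adjoint ip (B r) (adjoint ip (U t r) x)))).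

Definition Qts U B (t s : R) : X -> X := covariance_on U B t `[s, t].

Definition Qinf U B (t : R) : X -> X := covariance_on U B t `]-oo, t].

End EvolutionOperators.

Section FunctionSpaces.
Context (R : realType) (X V : normedModType R).

Definition Cb : set (X -> V) := [set f | continuous f /\ bounded_fun f].

Definition Lp_norm (m : {measure set (borel X) -> \bar R}) (p : R)
    (f : X -> V) : \bar R :=
  Lnorm m p%:E (fun x => (`|f x|)%:E).

Definition Lp_vector (m : {measure set (borel X) -> \bar R}) (p : R)
    : set (X -> V) :=
  [set f | measurable_fun [set: borel X] (f : borel X -> borel V) /\
           (Lp_norm m p f < +oo)%E].

(* An operator from L^p(m) to L^p(m'), whose elements are classes of functions
   modulo almost everywhere equality, is given by an action T on representatives
   which is compatible with these equalities. L and L' are the sets of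
   representatives of the elements of L^p(m) and of L^p(m'). *)
Record bounded_extension (m m' : {measure set (borel X) -> \bar R}) (p : R)
    (L L' : set (X -> V)) (P T : (X -> V) -> (X -> V)) : Prop := {
  ext_Cb : forall f, Cb f -> Cb (P f);
  ext_Lp : forall f, L f -> L' (T f);
  ext_ae : forall f g, L f -> L g ->
    {ae m, forall x, f x = g x} -> {ae m', forall x, T f x = T g x};
  ext_linear : forall a f g, L f -> L g ->
    {ae m', forall x, T (fun y => a *: f y + g y) x = a *: T f x + T g x};
  ext_bounded : exists C : R, forall f, L f ->
    (Lp_norm m' p (T f) <= C%:E * Lp_norm m p f)%E;
  ext_eq : forall f, Cb f -> {ae m', forall x, T f x = P f x} }.

Definition contraction_Lp (m m' : {measure set (borel X) -> \bar R}) (p : R)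
    (L : set (X -> V)) (T : (X -> V) -> (X -> V)) : Prop :=
  forall f, L f -> (Lp_norm m' p (T f) <= Lp_norm m p f)%E.

End FunctionSpaces.

Definition Lp_scalar (R : realType) (X : normedModType R)
    (m : {measure set (borel X) -> \bar R}) (p : R) : set (X -> R) :=
  [set f | (f : borel X -> R) \in Lfun m p%:E].

Section TransitionOperators.
Context (R : realType) (X : completeNormedModType R).
Variables (S : X -> X) (nu : probability (borel X) R).

Definition Pscalar (f : X -> R) (x : X) : R :=
  \int[nu]_y f (S x + (y : X)).

Definition Pvector (F : X -> X) (x : X) : X :=
  bochner nu (fun y : borel X => F (S x + (y : X))).

End TransitionOperators.

(* Main.v *)
Require Import Defs.
From HB Require Import structures.
From mathcomp Require Import all_boot all_order all_algebra.
From mathcomp Require Import sesquilinear.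
From mathcomp Require Import all_classical all_reals all_analysis.
From mathcomp Require Import measurable_realfun ring lra.
Import Order.TTheory GRing.Theory Num.Theory.
Import numFieldNormedType.Exports.
Local Open Scope classical_set_scope.
Local Open Scope ring_scope.

(** The heart of the matter is that the Gaussian measures form an evolution
    system of measures: mu t is the law of U t s x + y when x and y are
    independent with laws mu s and N t s ([gaussian_image]). Granting this, put
    P f x := \int f (U t s x + y) N t s (dy) for every f in L^p(mu t), and not
    only for bounded continuous f. Jensen's inequality in y followed by Tonelli
    gives \int |P f|^p d(mu s) <= \int \int |f (U t s x + y)|^p = \int |f|^p
    d(mu t), which is the contraction property ([mean_norm_contraction]); the
    same change of variables carries null sets of mu t to null sets
    ([ae_image]), so that P acts on classes, and Fubini gives the equality of
    the integrals. On bounded continuous functions nothing has changed, and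
    continuity of P f is dominated convergence ([transition_continuous]).

    Both sides of the identity for mu t have Gaussian one-dimensional marginals.
    On the right the variances add up ([centered_gaussian_conv]), and the flow
    property of U turns the splitting of the integral over ]-oo, t] at s into
    <Q(t, -oo) h, h> = <Q(s, -oo) U* h, U* h> + <Q(t, s) h, h> with U = U t s
    ([covariance_split]). A probability on a separable Hilbert space is
    determined by the integrals of the functions cos (<x, h> + c)
    ([measure_eq_of_waves]): the functions by which one may multiply without
    destroying the equality of all these integrals form an algebra closed under
    bounded pointwise limits, hence contain the indicators of half-spaces.

    The covariances and the vector-valued operator are Bochner integrals, which
    are only ever used through their scalar products with a fixed vector
    ([ip_bochner]). Existence of the integral rests on measurable selection of a
    nearest point in a dense sequence; its value is identified by testing
    against vectors, the Riesz theorem providing the candidate. The integrand of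
    the covariance over ]-oo, t] is integrable because a negative growth
    exponent of U exists. *)

Set Implicit Arguments.
Unset Strict Implicit.
Unset Printing Implicit Defensive.

(** * Riesz representation and adjoints *)

Section InnerProduct.
Context (R : realType) (X : completeNormedModType R).
Variable ip : {dot X for @idfun R}.
Hypothesis ip_norm : forall x : X, ip x x = `|x| ^+ 2.

Lemma ipC x y : ip x y = ip y x.
Proof. by rewrite hermC expr0 mul1r. Qed.

Lemma ipDl x y z : ip (x + y) z = ip x z + ip y z.
Proof. exact: linearDl. Qed.

Lemma ipDr x y z : ip z (x + y) = ip z x + ip z y.
Proof. exact: linearDr. Qed.

Lemma ipZl a x y : ip (a *: x) y = a * ip x y.
Proof. exact: linearZl_LR. Qed.

Lemma ipZr a x y : ip y (a *: x) = a * ip y x.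
Proof. by rewrite ipC ipZl ipC. Qed.

Lemma ipNl x y : ip (- x) y = - ip x y.
Proof. by rewrite -scaleN1r ipZl mulN1r. Qed.

Lemma ipNr x y : ip y (- x) = - ip y x.
Proof. by rewrite ipC ipNl ipC. Qed.

Lemma ipBl x y z : ip (x - y) z = ip x z - ip y z.
Proof. by rewrite ipDl ipNl. Qed.

Lemma ipBr x y z : ip z (x - y) = ip z x - ip z y.
Proof. by rewrite ipDr ipNr. Qed.

Lemma ip0l x : ip 0 x = 0.
Proof. by rewrite -(scale0r 0) ipZl mul0r. Qed.

Lemma ip0r x : ip x 0 = 0.
Proof. by rewrite ipC ip0l. Qed.

Lemma ip_suml I (r : seq I) (P : pred I) (F : I -> X) h :
  ip (\sum_(i <- r | P i) F i) h = \sum_(i <- r | P i) ip (F i) h.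
Proof. by apply: (big_morph (fun x => ip x h)) => [x y|]; rewrite ?ipDl ?ip0l. Qed.

Lemma normD_sqr x y : `|x + y| ^+ 2 = `|x| ^+ 2 + 2 * ip x y + `|y| ^+ 2.
Proof. by rewrite -!ip_norm ipDl !ipDr (ipC y x); ring. Qed.

Lemma cauchy_schwarz x y : `|ip x y| <= `|x| * `|y|.
Proof.
have [->|y0] := eqVneq y 0; first by rewrite ip0r !normr0 mulr0.
have y2 : 0 < `|y| ^+ 2 by rewrite exprn_gt0// normr_gt0.
rewrite -ler_sqr ?nnegrE ?mulr_ge0// exprMn real_normK ?num_real//.
have := normD_sqr x (- (ip x y / `|y| ^+ 2) *: y).
rewrite ipZr normrZ exprMn real_normK ?num_real// => H.
have := sqr_ge0 `|x + - (ip x y / `|y| ^+ 2) *: y|; rewrite H => G.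
have := mulr_ge0 G (ltW y2).
have -> : (`|x| ^+ 2 + 2 * (- (ip x y / `|y| ^+ 2) * ip x y) +
  (- (ip x y / `|y| ^+ 2)) ^+ 2 * `|y| ^+ 2) * `|y| ^+ 2 =
  `|x| ^+ 2 * `|y| ^+ 2 - ip x y ^+ 2.
  by field; rewrite normr_eq0.
by rewrite subr_ge0.
Qed.

Lemma ip_inj x y : (forall h, ip x h = ip y h) -> x = y.
Proof.
move=> H; apply/eqP; rewrite -subr_eq0 -normr_eq0 -sqrf_eq0 -ip_norm ipBl.
by rewrite H subrr.
Qed.

Lemma ip_continuous h : continuous (fun x => ip x h : R).
Proof.
move=> x; apply/cvgrPdist_le => e e0; near=> y.
rewrite -ipBl (le_trans (cauchy_schwarz _ _))//.
have h1 : 0 < `|h| + 1 by rewrite ltr_wpDl.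
rewrite (@le_trans _ _ (`|x - y| * (`|h| + 1)))//.
  by rewrite ler_wpM2l// lerDl.
rewrite -ler_pdivlMr//; near: y.
by apply: cvgr_dist_le; rewrite ?divr_gt0.
Unshelve. all: by end_near. Qed.

(** The minimizer of |x|^2 - 2 l(x) represents l: the parallelogram identity
    turns every minimizing sequence into a Cauchy one. *)
Lemma riesz (l : X -> R) (C : R) :
  (forall a x y, l (a *: x + y) = a * l x + l y) ->
  (forall x, `|l x| <= C * `|x|) ->
  exists z, forall x, l x = ip x z.
Proof.
move=> llin lbd.
have l0 : l 0 = 0.
  by have := llin (-1) 0 0; rewrite scaler0 addr0 => ->; rewrite mulN1r addNr.
have lZ a x : l (a *: x) = a * l x.
  by have := llin a x 0; rewrite addr0 l0 addr0.
have lD x y : l (x + y) = l x + l y.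
  by have := llin 1 x y; rewrite scale1r mul1r.
pose J (x : X) : R := `|x| ^+ 2 - 2 * l x.
have Jlb x : - C ^+ 2 <= J x.
  rewrite /J lerBrDr -subr_ge0.
  have := lbd x; rewrite ler_norml => /andP[_ lx].
  have : 0 <= (`|x| - C) ^+ 2 by exact: sqr_ge0.
  by nra.
pose m := inf (range J).
have hlb : has_lbound (range J) by exists (- C ^+ 2) => _ [x _ <-].
have hinf : has_inf (range J) by split => //; exists (J 0), 0.
have mJ x : m <= J x by apply: ge_inf => //; exists x.
have /choice[u uP] (n : nat) : exists x, J x < m + n.+1%:R^-1.
  have n1 : 0 < n.+1%:R^-1 :> R by rewrite invr_gt0.
  have [_ [x _ <-] xm] := inf_adherent n1 hinf.
  by exists x.
have par x y : `|x - y| ^+ 2 <= 2 * (J x - m) + 2 * (J y - m).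
  have := mJ (2^-1 *: (x + y)).
  rewrite /J lZ lD normrZ exprMn real_normK ?num_real//.
  have := normD_sqr x y; have := normD_sqr x (- y).
  rewrite ipNr normrN => -> ->.
  have e4 : (2^-1 : R) ^+ 2 = 4^-1 by rewrite exprVn; congr (_^-1); ring.
  by rewrite e4; lra.
have uc : cauchy (u @ \oo).
  apply/cauchyP => e e0.
  have e4 : 0 < e ^+ 2 / 4 by rewrite divr_gt0// exprn_gt0.
  have [N _ HN] : \forall n \near \oo, n.+1%:R^-1 < e ^+ 2 / 4 :> R.
    exact: (near_infty_natSinv_lt (PosNum e4)).
  exists (u N); suff : \forall n \near \oo, ball (u N) e (u n) by [].
  near=> n.
  rewrite -ball_normE /ball_/=.
  rewrite -ltr_sqr ?nnegrE ?(ltW e0)//.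
  apply: (le_lt_trans (par _ _)).
  have nN : (N <= n)%N by near: n; exact: nbhs_infty_ge.
  have := uP N; have := uP n; have /= := HN _ nN; have /= := HN _ (leqnn N).
  move: (N.+1%:R^-1) (n.+1%:R^-1) (J (u N)) (J (u n)) (e ^+ 2) => a b c d f.
  lra.
have /cvg_ex[z uz] : cvgn u by exact: cauchy_cvg.
have lc : continuous l.
  move=> x; apply/cvgrPdist_le => e e0; near=> y.
  rewrite (_ : l x - l y = l (x - y)); last first.
    by rewrite lD -(scaleN1r y) lZ mulN1r.
  rewrite (le_trans (lbd _))//.
  have C1 : 0 < `|C| + 1 by rewrite ltr_wpDl.
  rewrite (@le_trans _ _ ((`|C| + 1) * `|x - y|))//.
    by rewrite ler_wpM2r// (le_trans (ler_norm _))// lerDl.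
  rewrite mulrC -ler_pdivlMr//; near: y.
  by apply: cvgr_dist_le; rewrite ?divr_gt0.
have Jz : J z <= m.
  have Jc : J (u n) @[n --> \oo] --> J z.
    apply: cvgB; first by rewrite !expr2; apply: cvgM; exact: cvg_norm.
    apply: cvgM; first exact: cvg_cst.
    by apply: continuous_cvg; [exact: lc|exact: uz].
  have Jm : (m + n.+1%:R^-1) @[n --> \oo] --> m.
    rewrite -[X in _ --> X]addr0; apply: cvgD; first exact: cvg_cst.
    exact: cvg_harmonic.
  apply: (ler_cvg_to Jc Jm); near=> n; exact/ltW/uP.
exists z => x.
(* J (z + a x) >= J z for all a; the first-order term must vanish *)
have var a : 0 <= 2 * a * (ip z x - l x) + a ^+ 2 * `|x| ^+ 2.
  have := mJ (z + a *: x); move/(le_trans Jz).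
  rewrite /J normD_sqr lD lZ ipZr normrZ exprMn real_normK ?num_real//; lra.
rewrite ipC; apply/esym/eqP; rewrite -subr_eq0; apply/eqP.
set d := ip z x - l x in var *.
have [x0|x0] := eqVneq x 0.
  by rewrite /d x0 ip0r l0 subrr.
have x2 : 0 < `|x| ^+ 2 by rewrite exprn_gt0// normr_gt0.
have := var (- d / `|x| ^+ 2).
have -> : 2 * (- d / `|x| ^+ 2) * d + (- d / `|x| ^+ 2) ^+ 2 * `|x| ^+ 2
  = - (d ^+ 2 / `|x| ^+ 2) by field; rewrite normr_eq0.
rewrite oppr_ge0 pmulr_lle0 ?invr_gt0// => dd.
by apply/eqP; rewrite -sqrf_eq0 eq_le dd sqr_ge0.
Unshelve. all: by end_near. Qed.

Lemma bounded_operatorD {T : X -> X} : bounded_operator T ->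
  forall x y, T (x + y) = T x + T y.
Proof.
by move=> [+ _] => /(_ 1) H x y; have := H x y; rewrite !scale1r.
Qed.

Lemma bounded_operator0 {T : X -> X} : bounded_operator T -> T 0 = 0.
Proof.
move=> bT; have := bounded_operatorD bT 0 0.
by rewrite addr0 => /(congr1 (fun x => x - T 0)); rewrite subrr addrK.
Qed.

Lemma bounded_operatorZ {T : X -> X} : bounded_operator T ->
  forall a x, T (a *: x) = a *: T x.
Proof.
move=> bT a x; have := bT.1 a x 0.
by rewrite /= (bounded_operator0 bT) !addr0.
Qed.

Lemma opnorm_le (T : X -> X) (C : R) : bounded_operator T ->
  (opnorm T <= C%:E)%E -> forall x, `|T x| <= C * `|x|.
Proof.
move=> bT TC x; have [->|x0] := eqVneq x 0.
  by rewrite (bounded_operator0 bT) !normr0 mulr0.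
have nx : 0 < `|x| by rewrite normr_gt0.
have : ((`|T (`|x|^-1 *: x)|)%:E <= C%:E)%E.
  apply: le_trans TC; apply: ereal_sup_ubound; exists (`|x|^-1 *: x) => //=.
  by rewrite normrZ normfV normr_id mulVf// gt_eqF.
rewrite lee_fin (bounded_operatorZ bT) normrZ normfV normr_id.
by rewrite ler_pdivrMl// mulrC.
Qed.

Lemma opnorm_ge0 (T : X -> X) : (0 <= opnorm T)%E.
Proof.
apply: (@le_trans _ _ (`|T 0|)%:E); first by rewrite lee_fin.
by apply: ereal_sup_ubound; exists 0 => //=; rewrite normr0.
Qed.

Lemma bounded_operator_fine (T : X -> X) : bounded_operator T ->
  forall x, `|T x| <= fine (opnorm T) * `|x|.
Proof.
move=> bT; apply: opnorm_le => //; rewrite fineK//.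
by rewrite ge0_fin_numE ?opnorm_ge0//; case: bT.
Qed.

Lemma bounded_operator_continuous (T : X -> X) : bounded_operator T ->
  continuous T.
Proof.
move=> bT x; apply/cvgrPdist_le => e e0.
have C1 : 0 < fine (opnorm T) + 1 by rewrite ltr_wpDl// fine_ge0 ?opnorm_ge0.
near=> y.
have -> : T x - T y = T (x - y).
  by rewrite (bounded_operatorD bT) -(scaleN1r y) (bounded_operatorZ bT) scaleN1r.
rewrite (le_trans (bounded_operator_fine bT _))//.
rewrite (@le_trans _ _ ((fine (opnorm T) + 1) * `|x - y|))//.
  by rewrite ler_wpM2r// lerDl.
rewrite mulrC -ler_pdivlMr//; near: y.
by apply: cvgr_dist_le; rewrite ?divr_gt0.
Unshelve. all: by end_near. Qed.

Lemma adjointP (T : X -> X) : bounded_operator T ->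
  forall x y, ip (T x) y = ip x (adjoint ip T y).
Proof.
move=> bT x y; rewrite /adjoint; case: xgetP => [z _ ->//|] H; exfalso.
have [|w|z Hz] := @riesz (fun x => ip (T x) y) (fine (opnorm T) * `|y|).
- move=> a u v.
  by rewrite (bounded_operatorD bT) (bounded_operatorZ bT) ipDl ipZl.
- rewrite (le_trans (cauchy_schwarz _ _))// mulrAC ler_wpM2r//.
  exact: bounded_operator_fine.
by apply: (H z) => w.
Qed.

Lemma adjoint_le (T : X -> X) (C : R) : bounded_operator T ->
  (opnorm T <= C%:E)%E -> forall y, `|adjoint ip T y| <= C * `|y|.
Proof.
move=> bT TC y; set z := adjoint ip T y.
have [z0|z0] := eqVneq z 0.
  rewrite z0 normr0 mulr_ge0// -lee_fin; apply: le_trans TC.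
  exact: opnorm_ge0.
have nz : 0 < `|z| by rewrite normr_gt0.
rewrite -(ler_pM2r nz) -expr2 -ip_norm {2}/z -adjointP//.
rewrite (le_trans (ler_norm _))// (le_trans (cauchy_schwarz _ _))//.
by rewrite mulrAC ler_wpM2r// opnorm_le.
Qed.

Lemma adjointE (T : X -> X) y z : bounded_operator T ->
  (forall x, ip (T x) y = ip x z) -> adjoint ip T y = z.
Proof.
by move=> bT H; apply: ip_inj => h; rewrite ipC -adjointP// H ipC.
Qed.

End InnerProduct.

(** * Borel measurability in a separable Hilbert space *)

Section BorelMeasurability.
Context (R : realType) (X : completeNormedModType R).

Lemma separable_sequence : separable X ->
  exists x_ : nat -> X, x_ 0%N = 0 /\
    forall (x : X) (e : R), 0 < e -> exists n, `|x - x_ n| < e.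
Proof.
move=> [S cS dS]; have [s sS] : exists s : nat -> X, S `<=` range s.
  have [f finj] := elimT (countable_injP _) cS.
  have /choice[s sP] (n : nat) : exists x, forall y, S y -> f y = n -> x = y.
    have [[y [Sy fy]]|H] := pselect (exists y, S y /\ f y = n).
      exists y => z Sz fz; apply: finj; rewrite ?inE//.
      by rewrite fy fz.
    by exists 0 => y Sy fy; exfalso; apply: H; exists y.
  by exists s => y Sy; exists (f y) => //; apply: sP.
exists (fun n => if n is k.+1 then s k else 0); split => // x e e0.
have [y [xy Sy]] : (ball x e `&` S) !=set0.
  by apply: dS; [exists x; exact: ballxx|exact: ball_open].
have [n _ sny] := sS y Sy; exists n.+1; rewrite /= sny.
by move: xy; rewrite -ball_normE.
Qed.

Lemma borel_open (A : set X) : open A -> measurable (A : set (borel X)).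
Proof. by move=> oA; exact: sub_sigma_algebra. Qed.

Lemma continuous_borel (Y : completeNormedModType R) (f : X -> Y) :
  continuous f -> measurable_fun setT (f : borel X -> borel Y).
Proof.
move=> /continuousP cf; apply: (@measurability _ _ (borel X) (borel Y) setT f (@open Y) erefl).
move=> _ [B oB <-].
by rewrite setTI; apply: borel_open; exact: cf.
Qed.

Lemma continuous_borel_real (f : X -> R) :
  continuous f -> measurable_fun setT (f : borel X -> R).
Proof.
move=> /continuousP cf; apply: (measurability _ (RGenOInfty.measurableE R)).
move=> _ [_ [a ->] <-].
by rewrite setTI; apply: borel_open; apply: cf; exact: rray_open.
Qed.

Variable ip : {dot X for @idfun R}.
Hypothesis ip_norm : forall x : X, ip x x = `|x| ^+ 2.
Hypothesis X_separable : separable X.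

Lemma ip_measurable d (T : measurableType d) (f : T -> X) h :
  measurable_fun setT (f : T -> borel X) ->
  measurable_fun setT (fun x => ip (f x) h).
Proof.
move=> mf; apply: (measurableT_comp (f := fun x : borel X => ip x h)) => //.
by apply: continuous_borel_real; exact: ip_continuous.
Qed.

Lemma norm_measurable d (T : measurableType d) (f : T -> X) :
  measurable_fun setT (f : T -> borel X) ->
  measurable_fun setT (fun x => `|f x|).
Proof.
move=> mf; apply: (measurableT_comp (f := fun x : borel X => `|x : X|)) => //.
by apply: continuous_borel_real; exact: norm_continuous.
Qed.

(** The norm is a supremum of countably many functionals, so weakly measurable
    functions have measurable norms. *)
Lemma weak_norm_measurable d (T : measurableType d) (f : T -> X) :
  (forall h, measurable_fun setT (fun x => ip (f x) h)) ->
  measurable_fun setT (fun x => `|f x|).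
Proof.
move=> wf; have [x_ [_ xd]] := separable_sequence X_separable.
apply: (measurability _ (RGenOInfty.measurableE R)) => _ [_ [a ->] <-].
rewrite setTI.
have [a0|a0] := ltP a 0.
  rewrite (_ : _ @^-1` _ = setT)//; apply/seteqP; split => // x _ /=.
  by rewrite in_itv/= andbT (lt_le_trans a0).
have -> : (fun x => `|f x|) @^-1` `]a, +oo[ =
    \bigcup_n [set x | a * `|x_ n| < ip (f x) (x_ n)].
  apply/seteqP; split => [x|x [n _]]/=; rewrite in_itv/= andbT.
    move=> afx; have fx0 : 0 < `|f x| by exact: le_lt_trans afx.
    (* near f x, the gap <f x, y> - a |y| is close to |f x| (|f x| - a) *)
    pose e := `|f x| * (`|f x| - a) / (`|f x| + a).
    have [|n Hn] := xd (f x) e.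
      by rewrite divr_gt0 ?mulr_gt0 ?subr_gt0// ltr_pwDl.
    exists n => //=.
    have ab : `|x_ n| < `|f x| + e.
      rewrite -ltrBlDl (le_lt_trans _ Hn)// distrC.
      by rewrite (le_trans (ler_norm _))// ler_dist_dist.
    have := cauchy_schwarz ip_norm (f x) (f x - x_ n).
    rewrite ler_norml (ipBr ip) ip_norm => /andP[_ H].
    have H2 : `|f x| * `|f x - x_ n| < `|f x| * e by rewrite ltr_pM2l.
    have H3 : a * `|x_ n| <= a * (`|f x| + e) by rewrite ler_wpM2l// ltW.
    have H4 : (`|f x| + a) * e = `|f x| * (`|f x| - a).
      by rewrite /e mulrC divfK// gt_eqF// ltr_pwDl.
    move: H H2 H3 H4; rewrite expr2; move: {Hn ab} e => e.
    move: (ip (f x) (x_ n)) (`|f x|) (`|f x - x_ n|) (`|x_ n|) => i F G K.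
    by nra.
  move=> H.
  have := lt_le_trans H (le_trans (ler_norm _) (cauchy_schwarz ip_norm _ _)).
  have [->|xn0] := eqVneq (x_ n) 0; first by rewrite !normr0 !mulr0 ltxx.
  by rewrite ltr_pM2r// normr_gt0.
apply: bigcupT_measurable => n.
rewrite -[X in measurable X]setTI.
exact: (measurable_fun_ltr (measurable_cst _) (wf (x_ n))).
Qed.

(** Pettis: balls have measurable preimages because norms do, and every open
    set of a separable space is a countable union of balls. *)
Lemma weak_borel_measurable d (T : measurableType d) (f : T -> X) :
  (forall h, measurable_fun setT (fun x => ip (f x) h)) ->
  measurable_fun setT (f : T -> borel X).
Proof.
move=> wf; have [x_ [_ xd]] := separable_sequence X_separable.
apply: (@measurability _ _ T (borel X) setT f (@open X) erefl).
move=> _ [W oW <-]; rewrite setTI.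
have -> : f @^-1` W = \bigcup_(nk in [set nk : nat * nat |
    ball (x_ nk.1) nk.2.+1%:R^-1 `<=` W])
    [set x | `|f x - x_ nk.1| < nk.2.+1%:R^-1].
  apply/seteqP; split => x /=.
    move=> Wfx; have /nbhs_ballP[e /= e0 eW] : nbhs (f x) W by exact: open_nbhs_nbhs.
    have e2 : 0 < e / 2 by rewrite divr_gt0.
    have [k _ Hk] := near_infty_natSinv_lt (PosNum e2).
    have k0 : 0 < k.+1%:R^-1 :> R by rewrite invr_gt0.
    have [n Hn] := xd (f x) _ k0.
    exists (n, k) => //= y; rewrite -ball_normE /= => yk; apply: eW.
    rewrite -ball_normE /=.
    have := Hk k (leqnn k); rewrite /= => {}Hk.
    rewrite -(subrK (x_ n) (f x)) -addrA (le_lt_trans (ler_normD _ _))//.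
    by move: Hk Hn yk; move: (k.+1%:R^-1) (`|_|) (`|_|) => a b c; lra.
  move=> [[n k] /= H fx]; apply: H; rewrite -ball_normE/= distrC; exact: fx.
rewrite bigcup_mkcond.
apply: countable_bigcupT_measurable => // -[n k]; case: ifP => // _ /=.
rewrite -[X in measurable X]setTI.
apply: measurable_fun_ltr => //; apply: weak_norm_measurable => h.
under eq_fun do rewrite (ipBl ip).
exact: measurable_funB.
Qed.

Lemma ip_measurable2 d (T : measurableType d) (f g : T -> X) :
  measurable_fun setT (f : T -> borel X) ->
  measurable_fun setT (g : T -> borel X) ->
  measurable_fun setT (fun x => ip (f x) (g x)).
Proof.
move=> mf mg.
have -> : (fun x => ip (f x) (g x)) =
    (fun x => (`|f x + g x| ^+ 2 - `|f x| ^+ 2 - `|g x| ^+ 2) / 2).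
  by apply/funext => x; rewrite (normD_sqr ip_norm); field.
apply: measurable_funM => //; apply: measurable_funB.
  apply: measurable_funB; apply: measurable_funX; last exact: norm_measurable.
  apply: weak_norm_measurable => h; under eq_fun do rewrite (ipDl ip).
  by apply: measurable_funD; exact: ip_measurable.
by apply: measurable_funX; exact: norm_measurable.
Qed.

End BorelMeasurability.

(** * The Bochner integral *)

Section BochnerIntegral.
Context (R : realType) (X : completeNormedModType R).
Variable ip : {dot X for @idfun R}.
Hypothesis ip_norm : forall x : X, ip x x = `|x| ^+ 2.
Hypothesis X_separable : separable X.
Context d (T : measurableType d).
Variable mu : {measure set T -> \bar R}.
Implicit Types f : T -> X.

Lemma integrable_ip f h :
  measurable_fun setT (f : T -> borel X) ->
  mu.-integrable setT (fun x => (`|f x|)%:E) ->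
  mu.-integrable setT (fun x => (ip (f x) h)%:E).
Proof.
move=> mf intf; have := integrableZl measurableT `|h| intf.
apply: le_integrable => //.
  by apply/measurable_EFinP; exact: ip_measurable.
move=> x _; rewrite -EFinM !abse_EFin lee_fin (le_trans (cauchy_schwarz ip_norm _ _))//.
by rewrite mulrC ler_norm.
Qed.

Lemma integrable_sf (A : set T) c : measurable A -> (mu A < +oo)%E ->
  mu.-integrable setT (fun x => (\1_A x * c)%:E).
Proof.
move=> mA Aoo; under eq_fun do rewrite mulrC EFinM.
apply: integrableZl => //; apply/integrableP; split.
  by apply/measurable_EFinP; exact: measurable_indic.
under eq_integral do rewrite gee0_abs ?lee_fin//.
by rewrite integral_indic// setIT.
Qed.

Lemma sf_fun_ip (g : simple_function X mu) h x :
  ip (sf_fun g x) h = \sum_(i < sf_size g) \1_(sf_set g i) x * ip (sf_val g i) h.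
Proof. by rewrite /sf_fun ip_suml; apply: eq_bigr => i _; rewrite ipZl. Qed.

Lemma sf_fun_measurable (g : simple_function X mu) :
  measurable_fun setT (sf_fun g : T -> borel X).
Proof.
apply: (weak_borel_measurable ip_norm X_separable) => h.
under eq_fun do rewrite sf_fun_ip.
apply: measurable_sum => i; apply: measurable_funM => //.
exact: measurable_indic (sf_measurable g i).
Qed.

Lemma sf_integral_ip (g : simple_function X mu) h :
  mu.-integrable setT (fun x => (ip (sf_fun g x) h)%:E) /\
  \int[mu]_x ip (sf_fun g x) h = ip (sf_integral g) h.
Proof.
have E : (fun x => (ip (sf_fun g x) h)%:E) = (fun x =>
    \sum_(i < sf_size g) (\1_(sf_set g i) x * ip (sf_val g i) h)%:E)%E.
  by apply/funext => x; rewrite sf_fun_ip sumEFin.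
have I (i : 'I_(sf_size g)) :
    mu.-integrable setT (fun x => (\1_(sf_set g i) x * ip (sf_val g i) h)%:E).
  by apply: integrable_sf; [exact: sf_measurable|exact: sf_finite].
split; first by rewrite E; apply: integrable_sum.
rewrite /Rintegral E integral_sum//.
rewrite (eq_bigr (fun i : 'I_(sf_size g) =>
  (fine (mu (sf_set g i)) * ip (sf_val g i) h)%:E)) => [|i _].
  by rewrite sumEFin/= ip_suml; apply: eq_bigr => i _; rewrite ipZl.
have mi := sf_measurable g i; have fi := sf_finite g i.
have := integrable_sf 1 mi fi; under eq_fun do rewrite mulr1.
move=> I1; under eq_integral do rewrite mulrC EFinM.
rewrite integralZl// integral_indic// setIT mulrC EFinM.
by rewrite fineK// ge0_fin_numE.
Qed.

(** The distance from z to the integral of a simple function is estimated by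
    pairing the difference with itself, so that a weak integral z suffices and
    no Cauchy argument is needed. *)
Lemma sf_integral_cvg f (g : nat -> simple_function X mu) (z : X) :
  measurable_fun setT (f : T -> borel X) ->
  mu.-integrable setT (fun x => (`|f x|)%:E) ->
  (forall h, \int[mu]_x ip (f x) h = ip z h) ->
  bochner_approx f g -> sf_integral (g n) @[n --> \oo] --> z.
Proof.
move=> mf intf zP [_ L1].
have bnd n : ((`|z - sf_integral (g n)|)%:E <=
    \int[mu]_x (`|f x - sf_fun (g n) x|)%:E)%E.
  set I := (\int[mu]_x _)%E; set w := z - sf_integral (g n).
  have I0 : (0 <= I)%E by apply: integral_ge0 => x _; rewrite lee_fin.
  have [->|w0] := eqVneq w 0; first by rewrite normr0.
  have nw : 0 < `|w| by rewrite normr_gt0.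
  have mD : measurable_fun setT (fun x => `|f x - sf_fun (g n) x|).
    apply: (weak_norm_measurable ip_norm X_separable) => h.
    under eq_fun do rewrite (ipBl ip).
    apply: measurable_funB; apply: (ip_measurable ip_norm) => //.
    exact: sf_fun_measurable.
  have [ig Eg] := sf_integral_ip (g n) w.
  have If := @integrable_ip f w mf intf.
  suff : ((`|w| * `|w|)%:E <= `|w|%:E * I)%E.
    by rewrite EFinM lee_pmul2l.
  have -> : (`|w| * `|w|)%:E = (\int[mu]_x (ip (f x - sf_fun (g n) x) w)%:E)%E.
    rewrite -expr2 -ip_norm {1}/w (ipBl ip) -zP -Eg -RintegralB//.
    rewrite fineK.
      by apply: eq_integral => x _; rewrite (ipBl ip).
    apply: integrable_fin_num => //; exact: (integrableB measurableT If ig).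
  rewrite -ge0_integralZl//; last by apply/measurable_EFinP.
  apply: (le_trans (lee_abs _)).
  have mi : measurable_fun setT (fun x => (ip (f x - sf_fun (g n) x) w)%:E).
    apply/measurable_EFinP; under eq_fun do rewrite (ipBl ip).
    apply: measurable_funB; apply: (ip_measurable ip_norm) => //.
    exact: sf_fun_measurable.
  apply: (le_trans (le_abse_integral _ _ _)) => //.
  apply: ge0_le_integral => //.
  - exact: measurableT_comp.
  - apply/measurable_EFinP; exact: measurable_funM.
  move=> x _; rewrite abse_EFin -EFinM lee_fin.
  by rewrite mulrC (cauchy_schwarz ip_norm).
apply/cvgrPdist_lt => e e0.
have [N _ HN] : \forall n \near \oo,
    (\int[mu]_x (`|f x - sf_fun (g n) x|)%:E < e%:E)%E.
  have /fine_cvgP[fin cv] := L1.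
  have := cvgr_lt _ cv _ e0.
  move=> H; near=> n.
  have finn : (\int[mu]_x (`|f x - sf_fun (g n) x|)%:E \is a fin_num)%E.
    by near: n.
  rewrite -(fineK finn) lte_fin; near: n; exact: H.
exists N => // n Nn /=; rewrite -lte_fin; apply: le_lt_trans (bnd n) _.
exact: HN.
Unshelve. all: by end_near. Qed.


Fixpoint nearest (x_ : nat -> X) (n : nat) (y : X) : nat :=
  if n is m.+1 then
    if `|y - x_ m.+1| < `|y - x_ (nearest x_ m y)| then m.+1
    else nearest x_ m y
  else 0%N.

Lemma nearest_le x_ n y : (nearest x_ n y <= n)%N.
Proof. by elim: n => //= n IH; case: ifP => // _; exact: leqW. Qed.

Lemma nearest_min x_ n y i : (i <= n)%N ->
  `|y - x_ (nearest x_ n y)| <= `|y - x_ i|.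
Proof.
elim: n => [|n IH] /=; first by rewrite leqn0 => /eqP ->.
rewrite leq_eqVlt => /predU1P[->|]; first by case: ltP => // /ltW.
rewrite ltnS => /IH; case: ltP => // h1 h2; exact: le_trans (ltW h1) h2.
Qed.

Lemma nearest_measurable f x_ n :
  measurable_fun setT (f : T -> borel X) ->
  measurable_fun setT (fun t => nearest x_ n (f t)) /\
  measurable_fun setT (fun t => `|f t - x_ (nearest x_ n (f t))|).
Proof.
move=> mf; have mB y : measurable_fun setT (fun t => `|f t - y|).
  apply: (weak_norm_measurable ip_norm X_separable) => h.
  under eq_fun do rewrite (ipBl ip).
  by apply: measurable_funB => //; exact: (ip_measurable ip_norm).
elim: n => [|n [IH1 IH2]] /=; first by split.
have mb : measurable_fun setT
  (fun t => `|f t - x_ n.+1| < `|f t - x_ (nearest x_ n (f t))|).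
  exact: measurable_fun_ltr.
split; first exact: measurable_fun_ifT.
rewrite (_ : (fun _ => _) = (fun t =>
  if `|f t - x_ n.+1| < `|f t - x_ (nearest x_ n (f t))| then `|f t - x_ n.+1|
  else `|f t - x_ (nearest x_ n (f t))|)); last first.
  by apply/funext => t; case: ifP.
exact: measurable_fun_ifT.
Qed.

(** The approximants take the value x_ i on the set where x_ i is the selected
    point. They stay at distance at most |f| from f, because 0 is among the
    points, which dominates the convergence in mean. *)
Lemma bochner_approx_exists f :
  measurable_fun setT (f : T -> borel X) ->
  mu.-integrable setT (fun x => (`|f x|)%:E) ->
  exists g : nat -> simple_function X mu, bochner_approx f g.
Proof.
move=> mf intf; have [x_ [x00 xd]] := separable_sequence X_separable.
pose A n i := [set t | nearest x_ n (f t) = i /\ x_ i != 0].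
have mA n i : measurable (A n i).
  have [x0|xi] := eqVneq (x_ i) 0.
    rewrite (_ : A n i = set0)//; apply/seteqP; split => // t [/= _].
    by rewrite x0 eqxx.
  have [m1 _] := nearest_measurable x_ n mf.
  have := m1 measurableT [set i] I; rewrite setTI.
  congr measurable; apply/seteqP; split => t /=; first by move=> ni; split.
  by case.
have Aoo n i : (mu (A n i) < +oo)%E.
  have [x0|xi] := eqVneq (x_ i) 0.
    rewrite (_ : A n i = set0) ?measure0//; apply/seteqP; split => // t [/= _].
    by rewrite x0 eqxx.
  have c0 : 0 < `|x_ i| / 2 by rewrite divr_gt0// normr_gt0.
  have mnf : measurable_fun setT (fun t => (`|f t|)%:E).
    by case/integrableP : intf.
  have mB : measurable [set t | ((`|x_ i| / 2)%:E <= `| (`|f t|)%:E |)%E].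
    rewrite -[X in measurable X]setTI; apply: emeasurable_fun_c_infty => //.
    exact: measurableT_comp.
  have AB : A n i `<=` [set t | ((`|x_ i| / 2)%:E <= `| (`|f t|)%:E |)%E].
    move=> t [/= ni _]; rewrite lee_fin normr_id ler_pdivrMr//.
    have := nearest_min x_ (f t) (leq0n n); rewrite ni x00 subr0 => H.
    rewrite -[x_ i](subrK (f t)) (le_trans (ler_normD _ _))// distrC.
    by move: H; move: (`|_|) (`|_|) => a b; lra.
  apply: (@le_lt_trans _ _ (mu [set t | ((`|x_ i| / 2)%:E <= `| (`|f t|)%:E |)%E])).
    by apply: le_measure => //; rewrite inE.
  have := @le_integral_comp_abse _ _ _ mu setT measurableT _ (`|x_ i| / 2) id
    (@measurable_id _ _ _) (fun r r0 => r0) (fun x y _ _ xy => xy) mnf c0.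
  rewrite setTI => H; move: intf => /integrableP[_ foo].
  have := le_lt_trans H foo.
  by rewrite !ltey; apply: contra => /eqP ->; rewrite gt0_muley ?lte_fin.
pose g n := @SimpleFunction _ _ _ _ mu n.+1 (A n) x_ (mA n) (Aoo n).
have gE n t : sf_fun (g n) t = x_ (nearest x_ n (f t)).
  have kn : (nearest x_ n (f t) < n.+1)%N by rewrite ltnS nearest_le.
  rewrite /sf_fun /= (bigD1 (Ordinal kn))//= big1 ?addr0 => [|i ik].
    have [->|xk] := eqVneq (x_ (nearest x_ n (f t))) 0; first by rewrite scaler0.
    by rewrite indicE mem_set ?scale1r.
  rewrite indicE memNset ?scale0r// => -[ki _]; move/eqP: ik; apply.
  by apply/val_inj.
have cvf t : sf_fun (g n) t @[n --> \oo] --> f t.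
  apply/cvgrPdist_lt => e e0.
  have [N HN] := xd (f t) e e0; exists N => // n /= Nn.
  by rewrite gE (le_lt_trans _ HN)// nearest_min.
exists g; split; first exact: aeW.
rewrite -[X in _ --> X](@integral0 _ _ _ mu setT).
apply: (@dominated_cvg _ _ _ mu setT measurableT _ _ (fun t => (`|f t|)%:E)) => //.
- move=> n; apply/measurable_EFinP; under eq_fun do rewrite gE.
  by have [] := nearest_measurable x_ n mf.
- move=> t _; apply: cvg_EFin; first exact: nearW.
  rewrite -(normr0 X); apply: cvg_norm.
  rewrite -(subrr (f t)); apply: cvgB; [exact: cvg_cst|exact: cvf].
- move=> n t _; rewrite abse_EFin lee_fin normr_id gE.
  by have := nearest_min x_ (f t) (leq0n n); rewrite x00 subr0.
Qed.

(** The Riesz vector of h |-> \int <f, h> is the limit of every approximating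
    sequence, hence the only value that [bochner] can select. *)
Lemma ip_bochner f h :
  measurable_fun setT (f : T -> borel X) ->
  mu.-integrable setT (fun x => (`|f x|)%:E) ->
  ip (bochner mu f) h = \int[mu]_x ip (f x) h.
Proof.
move=> mf intf.
have Ih y : mu.-integrable setT (fun x => (ip (f x) y)%:E) by exact: integrable_ip.
have [|y|z zP] := @riesz R X ip ip_norm (fun y => \int[mu]_x ip (f x) y)
    (fine (\int[mu]_x (`|f x|)%:E)).
- move=> a u v; rewrite /= -RintegralZl//; last exact: Ih.
  rewrite -RintegralD//; last 2 first.
  - exact: (integrableZl measurableT a (Ih u)).
  - exact: Ih.
  by apply: eq_Rintegral => x _; rewrite (ipDr ip) (ipZr ip).
- rewrite -[leRHS]/((\int[mu]_x `|f x|) * `|y|) -RintegralZr//.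
  apply: (le_trans (le_normr_Rintegral measurableT (Ih y))).
  apply: le_Rintegral => //; first exact: integrable_norm (Ih y).
    exact: (integrableZr measurableT `|y| intf).
  by move=> x _; exact: cauchy_schwarz.
have zP' y : \int[mu]_x ip (f x) y = ip z y by rewrite zP ipC.
rewrite zP'; congr (ip _ h); rewrite /bochner.
have [g gP] := bochner_approx_exists mf intf.
case: xgetP => [v _ [g' g'P g'v]|H].
  apply: (@cvg_unique X _ (sf_integral (g' n) @[n --> \oo])) => //.
  exact: (sf_integral_cvg mf).
by exfalso; apply: (H z); exists g => //; exact: (sf_integral_cvg mf).
Qed.

End BochnerIntegral.

(** * Convolution of centered Gaussian laws on the line *)

Section GaussianConvolution.
Context (R : realType).
Implicit Types (a b v : R) (g : R -> \bar R).

(** The law defined by its density has that density as Radon-Nikodym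
    derivative, almost everywhere by uniqueness. *)
Lemma integral_normal_prob m s g : s != 0 ->
  measurable_fun setT g -> (forall x, 0 <= g x)%E ->
  (\int[normal_prob m s]_x g x =
   \int[lebesgue_measure]_x (g x * (normal_pdf m s x)%:E))%E.
Proof.
move=> s0 mg g0.
rewrite -(Radon_Nikodym_SigmaFinite.change_of_variables
  (normal_prob_dominates m s) g0 measurableT mg).
apply: ae_eq_integral => //.
- apply: emeasurable_funM => //.
  exact: (measurable_int _ (Radon_Nikodym_SigmaFinite.f_integrable (normal_prob_dominates m s))).
- apply: emeasurable_funM => //; apply/measurable_EFinP.
  exact: measurable_normal_pdf.
- apply: ae_eqe_mul2l; apply: integral_ae_eq => //=.
  + exact: Radon_Nikodym_SigmaFinite.f_integrable (normal_prob_dominates m s).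
  + apply/measurable_EFinP; exact: measurable_normal_pdf.
  + move=> A _ mA.
    by rewrite -Radon_Nikodym_SigmaFinite.f_integral//; exact: normal_prob_dominates.
Qed.

Lemma ge0_integral_shift g c : measurable_fun setT g -> (forall x, 0 <= g x)%E ->
  (\int[lebesgue_measure]_x g (x + c)%R = \int[lebesgue_measure]_x g x)%E.
Proof.
move=> mg g0; pose f : measurableTypeR R -> measurableTypeR R := fun x => x + c.
have mf : measurable_fun setT f by apply: measurable_funD.
transitivity (\int[pushforward lebesgue_measure f]_y g y)%E.
  by rewrite ge0_integral_pushforward.
apply: eq_measure_integral => A mA _; apply/esym/lebesgue_measure_unique => //=.
move=> _ [[x y]] _ <-; rewrite /pushforward.
have -> : f @^-1` `]x, y] = `](x - c), (y - c)]%classic.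
  by apply/seteqP; split => z /=; rewrite /f !in_itv/= ltrBlDr lerBrDr.
rewrite !lebesgue_measure_itv/= !lte_fin ltrD2r.
by case: ifP => // _; rewrite -!EFinB; congr EFin; ring.
Qed.

Lemma ge0_integral_opp g : measurable_fun setT g -> (forall x, 0 <= g x)%E ->
  (\int[lebesgue_measure]_x g (- x)%R = \int[lebesgue_measure]_x g x)%E.
Proof.
move=> mg g0; pose f : measurableTypeR R -> measurableTypeR R := -%R.
have mf : measurable_fun setT f by exact: oppr_measurable.
transitivity (\int[pushforward lebesgue_measure f]_y g y)%E.
  by rewrite ge0_integral_pushforward.
by apply: eq_measure_integral => A mA _; exact: lebesgue_measureN.
Qed.

(** Completing the square in x: the product of the two densities is the density
    of the sum, at z, times the conditional density of x given z. *)
Lemma normal_pdf_mul a b x z : 0 < a -> 0 < b ->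
  normal_pdf 0 (Num.sqrt a) x * normal_pdf 0 (Num.sqrt b) (z - x) =
  normal_pdf 0 (Num.sqrt (a + b)) z *
  normal_pdf (z * a / (a + b)) (Num.sqrt (a * b / (a + b))) x.
Proof.
move=> a0 b0; have ab : 0 < a + b by exact: addr_gt0.
have c0 : 0 < a * b / (a + b) by rewrite divr_gt0 ?mulr_gt0.
have sn v : 0 < v -> Num.sqrt v != 0 by move=> v0; rewrite gt_eqF// sqrtr_gt0.
rewrite !normal_pdfE ?sn// /normal_peak /normal_fun !sqr_sqrtr ?ltW//.
rewrite mulrACA [RHS]mulrACA -!expRD -!invfM -!sqrtrM
  ?mulr_ge0 ?mulrn_wge0 ?mulr_ge0 ?pi_ge0 ?ltW//.
congr (_ * _).
  by congr (_^-1); congr Num.sqrt; field; rewrite gt_eqF.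
by congr expR; field; rewrite !gt_eqF.
Qed.

(** After exchanging the integrals, the conditional density of
    [normal_pdf_mul] integrates to 1. *)
Lemma normal_conv a b g : 0 < a -> 0 < b ->
  measurable_fun setT g -> (forall x, 0 <= g x)%E ->
  (\int[normal_prob 0 (Num.sqrt a)]_x
     \int[normal_prob 0 (Num.sqrt b)]_y g (x + y)%R =
   \int[normal_prob 0 (Num.sqrt (a + b))]_z g z)%E.
Proof.
move=> a0 b0 mg g0; have ab : 0 < a + b by exact: addr_gt0.
have sn v : 0 < v -> Num.sqrt v != 0 by move=> v0; rewrite gt_eqF// sqrtr_gt0.
pose pa := normal_pdf 0 (Num.sqrt a); pose pb := normal_pdf 0 (Num.sqrt b).
have pb0 x : 0 <= pb x by exact: normal_pdf_ge0.
have pa0 x : 0 <= pa x by exact: normal_pdf_ge0.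
have mpa : measurable_fun setT pa by exact: measurable_normal_pdf.
have mpb : measurable_fun setT pb by exact: measurable_normal_pdf.
pose F (xz : R * R) : \bar R := (g xz.2 * (pb (xz.2 - xz.1))%:E)%E.
have F0 xz : (0 <= F xz)%E by rewrite mule_ge0// lee_fin.
have mF : measurable_fun setT F.
  apply: emeasurable_funM; first exact: measurableT_comp.
  apply/measurable_EFinP; apply: measurableT_comp => //.
  exact: measurable_funB.
have inner x : (\int[normal_prob 0 (Num.sqrt b)]_y g (x + y)%R =
    \int[lebesgue_measure]_z F (x, z))%E.
  have mgx : measurable_fun setT (fun y => g (x + y)%R).
    by apply: measurableT_comp => //; apply: measurable_funD.
  rewrite (integral_normal_prob 0 (sn _ b0) mgx (fun y => g0 _)).
  have mFx : measurable_fun setT (fun z => F (x, z)).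
    exact: (measurableT_comp mF (measurable_pair1 x)).
  rewrite -(@ge0_integral_shift (fun z => F (x, z)) x mFx (fun z => F0 (x, z))).
  by apply: eq_integral => y _; rewrite /F/= addrK addrC.
transitivity (\int[normal_prob 0 (Num.sqrt a)]_x \int[lebesgue_measure]_z F (x, z))%E.
  by apply: eq_integral => x _; exact: inner.
have mI : measurable_fun setT (fun x => \int[lebesgue_measure]_z F (x, z))%E.
  exact: (@measurable_fun_fubini_tonelli_F _ _ _ _ _ lebesgue_measure F mF F0).
have I0 x : (0 <= \int[lebesgue_measure]_z F (x, z))%E by apply: integral_ge0.
apply: (etrans (integral_normal_prob 0 (sn _ a0) mI I0)).
pose K (xz : R * R) : \bar R := (F xz * (pa xz.1)%:E)%E.
have mK : measurable_fun setT K.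
  apply: emeasurable_funM => //; apply/measurable_EFinP.
  exact: measurableT_comp.
have K0 xz : (0 <= K xz)%E by rewrite mule_ge0// lee_fin.
transitivity (\int[lebesgue_measure]_x \int[lebesgue_measure]_z K (x, z))%E.
  apply: eq_integral => x _; rewrite /K/= ge0_integralZr//.
    exact: (measurableT_comp mF (measurable_pair1 x)).
  by rewrite lee_fin.
apply: (etrans (@fubini_tonelli _ _ _ _ _ lebesgue_measure lebesgue_measure K mK K0)).
apply/esym; apply: (etrans (integral_normal_prob 0 (sn _ ab) mg g0)).
apply/esym; apply: eq_integral => z _.
transitivity (\int[lebesgue_measure]_x ((g z * (normal_pdf 0 (Num.sqrt (a + b)) z)%:E) *
  (normal_pdf (z * a / (a + b)) (Num.sqrt (a * b / (a + b))) x)%:E))%E.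
  apply: eq_integral => x _; rewrite /K /F/= -!muleA -!EFinM.
  by rewrite -normal_pdf_mul// mulrC.
rewrite ge0_integralZl//.
- by rewrite integral_normal_pdf mule1.
- by apply/measurable_EFinP; exact: measurable_normal_pdf.
- by move=> x _; rewrite lee_fin normal_pdf_ge0.
- by rewrite mule_ge0// lee_fin normal_pdf_ge0.
Qed.

(** The law [real_gaussian 0 v] with its structure of probability measure,
    which the integration theorems require. *)
Definition centered_gaussian v : probability (measurableTypeR R) R :=
  if 0 < v then (normal_prob 0 (Num.sqrt v) : probability (measurableTypeR R) R)
  else (\d_(0 : measurableTypeR R) : probability (measurableTypeR R) R).

Lemma centered_gaussianE v : 0 < v ->
  centered_gaussian v =
  (normal_prob 0 (Num.sqrt v) : probability (measurableTypeR R) R).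
Proof. by rewrite /centered_gaussian => ->. Qed.

Lemma real_gaussianE v A : real_gaussian 0 v A = centered_gaussian v A.
Proof. by rewrite /real_gaussian /centered_gaussian; case: ifP. Qed.

Lemma centered_gaussian_conv a b g : 0 <= a -> 0 <= b ->
  measurable_fun setT g -> (forall x, 0 <= g x)%E ->
  (\int[centered_gaussian a]_x \int[centered_gaussian b]_y g ((x : R) + (y : R))%R =
   \int[centered_gaussian (a + b)]_z g z)%E.
Proof.
move=> a0 b0 mg g0; have mgx (x : R) : measurable_fun setT (fun y : R => g (x + y)%R).
  by apply: measurableT_comp => //; apply: measurable_funD.
have [a1|] := ltP 0 a; last first.
  move=> a1; have -> : a = 0 by apply/eqP; rewrite eq_le a0 a1.
  rewrite add0r {1}/centered_gaussian ltxx integral_dirac//; last first.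
    pose G (xy : R * R) := g (xy.1 + xy.2).
    have mG : measurable_fun setT G.
      by apply: measurableT_comp => //; exact: measurable_funD.
    exact: (@measurable_fun_fubini_tonelli_F _ _ _ _ _ (centered_gaussian b) G mG (fun xy => g0 _)).
  by rewrite diracT mul1e; apply: eq_integral => y _; rewrite add0r.
have [b1|] := ltP 0 b; last first.
  move=> b1; have -> : b = 0 by apply/eqP; rewrite eq_le b0 b1.
  rewrite addr0; apply: eq_integral => x _.
  rewrite {1}/centered_gaussian ltxx integral_dirac//; last exact: mgx.
  by rewrite diracT mul1e addr0.
rewrite (centered_gaussianE a1) (centered_gaussianE b1).
rewrite (centered_gaussianE (addr_gt0 a1 b1)).
exact: (normal_conv a1 b1 mg g0).
Qed.

End GaussianConvolution.

(** * Measures with the same Fourier transform *)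

Section BoundedMultipliers.
Context (R : realType) (X : completeNormedModType R).
Variable ip : {dot X for @idfun R}.
Hypothesis ip_norm : forall x : X, ip x x = `|x| ^+ 2.
Hypothesis X_separable : separable X.
Variables m1 m2 : probability (borel X) R.

Definition bounded_measurable (f : X -> R) : Prop :=
  measurable_fun setT (f : borel X -> R) /\ exists C, forall x, `|f x| <= C.

Lemma bounded_measurable_integrable (m : probability (borel X) R) f :
  bounded_measurable f -> m.-integrable setT (EFin \o f).
Proof.
move=> [mf [C fC]]; apply: measurable_bounded_integrable => //.
  by rewrite (le_lt_trans (probability_le1 _ _))// ltry.
exists C; split; first exact: num_real.
by move=> y Cy x _ /=; rewrite (le_trans (fC x))// ltW.
Qed.

Lemma bounded_measurableM f g : bounded_measurable f -> bounded_measurable g ->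
  bounded_measurable (fun x => f x * g x).
Proof.
move=> [mf [C fC]] [mg [K gK]]; split; first exact: measurable_funM.
by exists (C * K) => x; rewrite normrM ler_pM.
Qed.

Lemma bounded_measurableD f g : bounded_measurable f -> bounded_measurable g ->
  bounded_measurable (fun x => f x + g x).
Proof.
move=> [mf [C fC]] [mg [K gK]]; split; first exact: measurable_funD.
by exists (C + K) => x; rewrite (le_trans (ler_normD _ _))// lerD.
Qed.

Lemma bounded_measurable_cst a : bounded_measurable (fun=> a).
Proof. by split => //; exists `|a|. Qed.

Definition wave (h : X) (c : R) (x : X) : R := cos (ip x h + c).

Lemma bounded_measurable_wave h c : bounded_measurable (wave h c).
Proof.
split; last by exists 1 => x; exact: cos_max.
apply: (measurableT_comp (f := @cos R)).
  by apply: continuous_measurable_fun; exact: continuous_cos.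
apply: measurable_funD => //.
exact: (@ip_measurable R X ip ip_norm _ (borel X) id h (@measurable_id _ _ _)).
Qed.

(** Comparing the integrals against all waves, and not only the integrals,
    makes this class stable under multiplication by waves. *)
Definition same_waves (f : X -> R) : Prop :=
  bounded_measurable f /\
  forall h c, \int[m1]_x (f x * wave h c x) = \int[m2]_x (f x * wave h c x).

Definition multiplier (w : X -> R) : Prop :=
  bounded_measurable w /\
  forall f, same_waves f -> same_waves (fun x => f x * w x).

Lemma same_waves_lin a b f g : same_waves f -> same_waves g ->
  same_waves (fun x => a * f x + b * g x).
Proof.
move=> [bf Hf] [bg Hg]; split.
  by apply: bounded_measurableD; apply: bounded_measurableM => //;
    exact: bounded_measurable_cst.
move=> h c.
have bfw := bounded_measurableM bf (bounded_measurable_wave h c).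
have bgw := bounded_measurableM bg (bounded_measurable_wave h c).
have E m : \int[m : probability (borel X) R]_x ((a * f x + b * g x) * wave h c x) =
    a * (\int[m]_x (f x * wave h c x)) + b * (\int[m]_x (g x * wave h c x)).
  rewrite -!RintegralZl//; try exact: bounded_measurable_integrable.
  rewrite -RintegralD//.
  - by apply: eq_Rintegral => x _; ring.
  - apply: bounded_measurable_integrable; apply: bounded_measurableM => //.
    exact: bounded_measurable_cst.
  - apply: bounded_measurable_integrable; apply: bounded_measurableM => //.
    exact: bounded_measurable_cst.
by rewrite !E Hf Hg.
Qed.

Lemma bounded_measurable_lim (w_ : nat -> X -> R) w C :
  (forall n, bounded_measurable (w_ n)) ->
  (forall n x, `|w_ n x| <= C) ->
  (forall x, w_ n x @[n --> \oo] --> w x) -> bounded_measurable w.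
Proof.
move=> bw wC ww; split.
  apply: (@measurable_fun_cvg _ (borel X) R setT w_) => [n|x _]; [exact: (bw n).1|exact: ww].
exists C => x; apply: (ler_cvg_to (cvg_norm (ww x)) (cvg_cst C)).
exact: nearW.
Qed.

Lemma Rintegral_bounded_cvg (m : probability (borel X) R) (w_ : nat -> X -> R) w C :
  (forall n, bounded_measurable (w_ n)) ->
  (forall n x, `|w_ n x| <= C) ->
  (forall x, w_ n x @[n --> \oo] --> w x) ->
  \int[m]_x w_ n x @[n --> \oo] --> \int[m]_x w x.
Proof.
move=> bw wC ww; have bwl := bounded_measurable_lim bw wC ww.
apply: fine_cvg; rewrite fineK; last first.
  by apply: integrable_fin_num => //; exact: bounded_measurable_integrable.
apply: (@dominated_cvg _ (borel X) _ m setT measurableT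
  (fun n x => (w_ n x)%:E) _ (fun=> C%:E)) => //.
- by move=> n; apply/measurable_EFinP; exact: (bw n).1.
- by move=> x _; apply: cvg_EFin; [exact: nearW|exact: ww].
- exact: (bounded_measurable_integrable m (bounded_measurable_cst C)).
- by move=> n x _; rewrite lee_fin.
Qed.

Lemma same_waves_lim (f_ : nat -> X -> R) f C :
  (forall n, same_waves (f_ n)) ->
  (forall n x, `|f_ n x| <= C) ->
  (forall x, f_ n x @[n --> \oo] --> f x) -> same_waves f.
Proof.
move=> sf fC ff; split.
  by apply: (bounded_measurable_lim (w_ := f_)) fC ff => n; exact: (sf n).1.
move=> h c.
have H (m : probability (borel X) R) :
    \int[m]_x (f_ n x * wave h c x) @[n --> \oo] --> \int[m]_x (f x * wave h c x).
  apply: (@Rintegral_bounded_cvg m (fun n x => f_ n x * wave h c x) _ C).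
  - move=> n; apply: bounded_measurableM; first exact: (sf n).1.
    exact: bounded_measurable_wave.
  - move=> n x; rewrite normrM -[C]mulr1 ler_pM//; exact: cos_max.
  - by move=> x; apply: cvgM; [exact: ff|exact: cvg_cst].
have E : (fun n => \int[m1]_x (f_ n x * wave h c x)) =
    (fun n => \int[m2]_x (f_ n x * wave h c x)).
  by apply/funext => n; exact: (sf n).2.
have H1 := H m1; rewrite E in H1.
exact: (cvg_unique _ H1 (H m2)).
Qed.

Lemma multiplierM v w : multiplier v -> multiplier w ->
  multiplier (fun x => v x * w x).
Proof.
move=> [bv Hv] [bw Hw]; split; first exact: bounded_measurableM.
move=> f /Hv/Hw; congr same_waves.
by apply/funext => x; rewrite mulrA.
Qed.

Lemma multiplier_lin a b v w : multiplier v -> multiplier w ->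
  multiplier (fun x => a * v x + b * w x).
Proof.
move=> [bv Hv] [bw Hw]; split.
  by apply: bounded_measurableD; apply: bounded_measurableM => //;
    exact: bounded_measurable_cst.
move=> f sf; have := same_waves_lin a b (Hv _ sf) (Hw _ sf); congr same_waves.
by apply/funext => x; ring.
Qed.

Lemma multiplier1 : multiplier (fun=> 1).
Proof.
split; first exact: bounded_measurable_cst.
by move=> f; under [X in _ -> same_waves X]eq_fun do rewrite mulr1.
Qed.

Lemma multiplierX w n : multiplier w -> multiplier (fun x => w x ^+ n).
Proof.
move=> mw; elim: n => [|n IH].
  by under [X in multiplier X]eq_fun do rewrite expr0; exact: multiplier1.
by under [X in multiplier X]eq_fun do rewrite exprS; exact: multiplierM.
Qed.

Lemma multiplier_lim (w_ : nat -> X -> R) w C :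
  (forall n, multiplier (w_ n)) ->
  (forall n x, `|w_ n x| <= C) ->
  (forall x, w_ n x @[n --> \oo] --> w x) -> multiplier w.
Proof.
move=> mw wC ww; split.
  by apply: (bounded_measurable_lim (w_ := w_)) wC ww => n; exact: (mw n).1.
move=> f sf; have [_ [K fK]] := sf.1.
apply: (@same_waves_lim (fun n x => f x * w_ n x) _ (K * C)).
- by move=> n; exact: (mw n).2.
- by move=> n x; rewrite normrM ler_pM.
- by move=> x; apply: cvgM; [exact: cvg_cst|exact: ww].
Qed.

(** The product of two waves is a combination of two waves. *)
Lemma multiplier_wave h c : multiplier (wave h c).
Proof.
split; first exact: bounded_measurable_wave.
move=> f [bf Hf]; split.
  by apply: bounded_measurableM => //; exact: bounded_measurable_wave.
move=> k e.
have E (m : probability (borel X) R) :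
    \int[m]_x (f x * wave h c x * wave k e x) =
    2^-1 * (\int[m]_x (f x * wave (h + k) (c + e) x)) +
    2^-1 * (\int[m]_x (f x * wave (h - k) (c - e) x)).
  have b1 := bounded_measurableM bf (bounded_measurable_wave (h + k) (c + e)).
  have b2 := bounded_measurableM bf (bounded_measurable_wave (h - k) (c - e)).
  rewrite -!RintegralZl//; try exact: bounded_measurable_integrable.
  rewrite -RintegralD//.
  - apply: eq_Rintegral => x _; rewrite /wave (ipDr ip) (ipBr ip).
    have -> : ip x h + ip x k + (c + e) = (ip x h + c) + (ip x k + e) by ring.
    have -> : ip x h - ip x k + (c - e) = (ip x h + c) - (ip x k + e) by ring.
    move: (ip x h + c) (ip x k + e) => y z.
    by rewrite cosD cosB; field.
  - apply: bounded_measurable_integrable; apply: bounded_measurableM => //.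
    exact: bounded_measurable_cst.
  - apply: bounded_measurable_integrable; apply: bounded_measurableM => //.
    exact: bounded_measurable_cst.
by rewrite !E !Hf.
Qed.

(** (1 - u^n)^(n 2^n) tends to 1 for 0 <= u < 1/2, by Bernoulli's inequality, and to 0
    for 1/2 <= u <= 1: polynomials in u converge boundedly to an indicator. *)
Lemma threshold_cvg (u : R) : 0 <= u <= 1 ->
  (1 - u ^+ n) ^+ (n * 2 ^ n) @[n --> \oo] --> ((u < 2^-1)%R%:R : R).
Proof.
move=> /andP[u0 u1].
have un0 n : 0 <= u ^+ n by exact: exprn_ge0.
have un1 n : u ^+ n <= 1 by exact: exprn_ile1.
have bern (y : R) k : -1 <= y -> 1 + k%:R * y <= (1 + y) ^+ k.
  move=> y1; elim: k => [|k IH]; first by rewrite mul0r addr0 expr0.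
  have y10 : 0 <= 1 + y by lra.
  have := ler_wpM2r y10 IH; rewrite -exprSr; apply: le_trans.
  have : 0 <= k%:R * y ^+ 2 by rewrite mulr_ge0// sqr_ge0.
  rewrite -natr1; move: (k%:R : R) => K; nra.
have [u2|u2] := ltP u 2^-1.
  (* lower bound 1 - n (2u)^n *)
  have [q0 q1] : 0 <= 2 * u /\ 2 * u < 1 by lra.
  have d0 : 0 < (1 - 2 * u) / 2 by lra.
  have aux n : n%:R * (2 * u) ^+ n * ((1 - 2 * u) / 2) <=
      (2 * u + (1 - 2 * u) / 2) ^+ n.
    move: (2 * u) ((1 - 2 * u) / 2) q0 q1 d0 => q e q0 q1 e0.
    elim: n => [|n IH]; first by rewrite !mul0r expr0.
    have H1 : 0 <= q ^+ n by exact: exprn_ge0.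
    have H2 : q ^+ n <= (q + e) ^+ n.
      by apply: lerXn2r; rewrite ?nnegrE ?addr_ge0 ?lerDl// ltW.
    rewrite -natr1 !exprS; move: H1 H2 IH.
    move: (q ^+ n) ((q + e) ^+ n) (n%:R : R) => a b k H1 H2 IH.
    have A1 := ler_wpM2l q0 IH.
    have A2 : q * (a * e) <= a * e by rewrite ler_piMl ?mulr_ge0// ltW.
    have A3 : a * e <= b * e by rewrite ler_wpM2r// ltW.
    by lra.
  have cv : 1 - n%:R * (2 * u) ^+ n @[n --> \oo] --> (1 : R).
    rewrite -[X in _ --> X]subr0; apply: cvgB; first exact: cvg_cst.
    have r1 : `|2 * u + (1 - 2 * u) / 2| < 1 by rewrite ger0_norm; lra.
    have cvr := cvg_geometric ((1 - 2 * u) / 2)^-1 r1.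
    apply: squeeze_cvgr (cvg_cst 0) cvr; apply: nearW => n /=.
    rewrite mulr_ge0 ?exprn_ge0//= ler_pdivlMl// mulrC; exact: aux.
  change ((1 - u ^+ n) ^+ (n * 2 ^ n) @[n --> \oo] --> (1 : R)).
  have c1 : (fun _ : nat => 1 : R) n @[n --> \oo] --> (1 : R) by exact: cvg_cst.
  refine (@squeeze_cvgr _ _ _ R (fun n => 1 - n%:R * (2 * u) ^+ n) (fun=> 1)
    (fun n => (1 - u ^+ n) ^+ (n * 2 ^ n)) _ 1 cv c1); apply: nearW => n; apply/andP; split.
    have := bern (- u ^+ n) (n * 2 ^ n)%N; rewrite lerN2 => /(_ (un1 n)).
    by rewrite natrM natrX mulrN -mulrA exprMn.
  by rewrite exprn_ile1// ?subr_ge0// gerBl.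
(* upper bound by the inverse of (1 + u^n)^(n 2^n) *)
have cv : (n.+1%:R^-1 : R) @[n --> \oo] --> (0 : R) by exact: cvg_harmonic.
change ((1 - u ^+ n) ^+ (n * 2 ^ n) @[n --> \oo] --> (0 : R)).
have c0 : (fun _ : nat => 0 : R) n @[n --> \oo] --> (0 : R) by exact: cvg_cst.
refine (@squeeze_cvgr _ _ _ R (fun=> 0) (fun n => n.+1%:R^-1)
  (fun n => (1 - u ^+ n) ^+ (n * 2 ^ n)) _ 0 c0 cv); apply: nearW => n; apply/andP; split.
  by rewrite exprn_ge0// subr_ge0.
rewrite -[leRHS]mul1r ler_pdivlMr//.
have B : n.+1%:R <= (1 + u ^+ n) ^+ (n * 2 ^ n).
  apply: le_trans (bern (u ^+ n) (n * 2 ^ n)%N _); last by rewrite (le_trans _ (un0 n))// lerN10.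
  rewrite -natr1 addrC lerD2l natrM natrX -mulrA -exprMn ler_peMr//.
  by rewrite exprn_ege1// -(@ler_pM2l _ 2^-1)// mulKf// mulr1.
apply: (@le_trans _ _ ((1 - u ^+ n) ^+ (n * 2 ^ n) * (1 + u ^+ n) ^+ (n * 2 ^ n))).
  by rewrite ler_wpM2l// exprn_ge0// subr_ge0.
rewrite -exprMn exprn_ile1//.
  by rewrite mulr_ge0// ?subr_ge0// addr_ge0.
by have := sqr_ge0 (u ^+ n); move: (u ^+ n) => v; nra.
Qed.

Lemma multiplier_threshold (u : X -> R) :
  (forall x, 0 <= u x <= 1) -> multiplier u ->
  multiplier (fun x => (u x < 2^-1)%R%:R).
Proof.
move=> u01 mu.
apply: (@multiplier_lim (fun n x => (1 - u x ^+ n) ^+ (n * 2 ^ n)) _ 1).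
- move=> n; apply: multiplierX.
  have := multiplier_lin 1 (-1) multiplier1 (multiplierX n mu).
  by congr multiplier; apply/funext => x; rewrite mulr1 mulN1r.
- move=> n x; have /andP[u0 u1] := u01 x.
  rewrite normrX exprn_ile1// ger0_norm ?subr_ge0 ?exprn_ile1//.
  by rewrite gerBl exprn_ge0.
- by move=> x; exact: threshold_cvg.
Qed.

(** At scale n the half-space is approximated by {sin ((<x, h> - a) / n) > 0},
    which agrees with it as soon as |<x, h> - a| < n pi. *)
Lemma multiplier_halfspace h a : multiplier (fun x => (a < ip x h)%R%:R).
Proof.
pose s n x := sin ((ip x h - a) / n.+1%:R).
apply: (@multiplier_lim (fun n x => ((1 - s n x) / 2 < 2^-1)%R%:R) _ 1).
- move=> n; apply: multiplier_threshold => [x|].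
    by have := sin_max ((ip x h - a) / n.+1%:R); rewrite ler_norml -/(s n x); lra.
  have := multiplier_lin 2^-1 (- 2^-1) multiplier1
    (multiplier_wave (n.+1%:R^-1 *: h) (- a / n.+1%:R - pi / 2)).
  congr multiplier; apply/funext => x.
  rewrite /wave addrA cosBpihalf (ipZr ip) /s.
  have -> : n.+1%:R^-1 * ip x h + - a / n.+1%:R = (ip x h - a) / n.+1%:R :> R by ring.
  by field.
- by move=> n x; case: (_ < _); rewrite ?normr1 ?normr0.
move=> x; apply/cvgrPdist_le => e e0.
have [N _ HN] := nbhs_infty_gtr (`|ip x h - a| / pi).
exists N => // n /HN /= {}HN.
suff -> : ((1 - s n x) / 2 < 2^-1) = (a < ip x h) by rewrite subrr normr0 ltW.
have xn : `|ip x h - a| / n.+1%:R < pi.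
  rewrite ltr_pdivrMr// mulrC -ltr_pdivrMr ?pi_gt0// (lt_le_trans HN)//.
  by rewrite ler_nat.
have [ax|ax] := ltP a (ip x h).
  have : 0 < s n x.
    apply: sin_gt0_pi; rewrite divr_gt0 ?subr_gt0//=.
    by move: xn; rewrite gtr0_norm// subr_gt0.
  by lra.
have : s n x <= 0.
  have [xa|ne] := eqVneq (ip x h) a; first by rewrite /s xa subrr mul0r sin0.
  have lt : ip x h < a by rewrite lt_neqAle ne.
  rewrite /s -[X in sin X]opprK sinN oppr_le0 ltW//.
  apply: sin_gt0_pi; rewrite -mulNr divr_gt0//= ?opprB ?subr_gt0//.
  by move: xn; rewrite distrC gtr0_norm// subr_gt0.
by move=> ?; apply/negbTE; rewrite -leNgt; lra.
Qed.

Lemma multiplier_halfspaces (s : seq (X * R)) :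
  multiplier (fun x => (all (fun p => p.2 < ip x p.1)%R s)%:R).
Proof.
elim: s => [|p s IH] /=; first exact: multiplier1.
have := multiplierM (multiplier_halfspace p.1 p.2) IH.
by congr multiplier; apply/funext => x; rewrite -natrM mulnb.
Qed.

(** The constant 1 has the same integral against all waves; multiply it by the
    indicator and test against the wave 1. *)
Lemma multiplier_measure (A : set X) :
  (forall h c, \int[m1]_x wave h c x = \int[m2]_x wave h c x) ->
  measurable (A : set (borel X)) -> multiplier (\1_A : X -> R) -> m1 A = m2 A.
Proof.
move=> H mA [_ mw].
have s1 : same_waves (fun=> 1).
  split; first exact: bounded_measurable_cst.
  move=> h c; have := H h c.
  congr (_ = _); by apply: eq_Rintegral => x _; rewrite mul1r.
have [_ /(_ 0 0)] := mw _ s1.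
have E (m : probability (borel X) R) :
    \int[m]_x (1 * \1_A x * wave 0 0 x) = fine (m A).
  rewrite -[A in RHS]setIT -(integral_indic m measurableT mA) /Rintegral.
  congr fine; apply: eq_integral => x _.
  by rewrite /wave (ip0r ip) addr0 cos0 mulr1 mul1r.
by rewrite !E => F; rewrite -[LHS]fineK ?fin_num_measure// F fineK ?fin_num_measure.
Qed.

(** Cramér-Wold: half-spaces generate the Borel sets of a separable space. *)
Lemma measure_eq_of_waves :
  (forall h c, \int[m1]_x wave h c x = \int[m2]_x wave h c x) ->
  forall A, measurable (A : set (borel X)) -> m1 A = m2 A.
Proof.
move=> H.
pose HS (s : seq (X * R)) : set X := [set x | all (fun p => p.2 < ip x p.1) s].
pose G : set (set X) := [set HS s | s in setT].
have mHS s : measurable (HS s : set (borel X)).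
  have mw := (multiplier_halfspaces s).1.1.
  have := mw measurableT [set 1] (measurable_set1 _); rewrite setTI.
  congr measurable; apply/seteqP; split => x /=; rewrite /HS/=.
    by case: (all _ _) => // /eqP; rewrite eq_sym oner_eq0.
  by move=> ->.
have genG : @measurable _ (borel X) = <<s G >>.
  apply/seteqP; split.
    pose idG : g_sigma_algebraType G -> X := idfun.
    have mid : measurable_fun setT (idG : g_sigma_algebraType G -> borel X).
      apply: (weak_borel_measurable ip_norm X_separable) => h.
      apply: (measurability _ (RGenOInfty.measurableE R)) => _ [_ [a ->] <-].
      rewrite setTI; apply: sub_sigma_algebra; exists [:: (h, a)] => //.
    move=> A mA; have := mid measurableT A mA; rewrite setTI.
    by congr measurable.
  apply: smallest_sub; first exact: sigma_algebra_measurable.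
  by move=> _ [s _ <-]; exact: mHS.
apply: (@measure_unique _ R (borel X) G (fun=> setT)).
- exact: genG.
- move=> _ _ [s _ <-] [t _ <-]; exists (s ++ t) => //.
  apply/seteqP; split => x; rewrite /HS/= all_cat.
    by move/andP.
  by move=> [-> ->].
- by move=> _; exists [::] => //; apply/seteqP.
- by rewrite bigcup_const.
- move=> _ [s _ <-]; apply: multiplier_measure => //.
  have := multiplier_halfspaces s; congr multiplier; apply/funext => x.
  by rewrite indicE; congr (_%:R); congr nat_of_bool; apply/idP/idP; rewrite inE.
- by move=> _; rewrite (le_lt_trans (probability_le1 _ _))// ltry.
Qed.

End BoundedMultipliers.

(** * Splitting the covariance at an intermediate time *)

Section Covariance.
Context (R : realType) (X : completeNormedModType R).
Variable ip : {dot X for @idfun R}.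
Hypothesis ip_norm : forall x : X, ip x x = `|x| ^+ 2.
Hypothesis X_separable : separable X.
Variables (D : R -> set X) (A : R -> X -> X) (U : R -> R -> X -> X).
Hypothesis U_evolution : evolution_operator D A U.
Hypothesis U_stable : (omega0 U < 0)%E.
Variable B : R -> X -> X.
Hypothesis B_operator : forall t, bounded_operator (B t).
Hypothesis B_bounded : exists K : R, forall t, (opnorm (B t) <= K%:E)%E.
Hypothesis B_measurable : forall x : X,
  measurable_fun [set: R] ((fun t => B t x) : R -> borel X).

Let past (t : R) : set R := `]-oo, t].

Let mpast t : measurable (past t). Proof. exact: measurable_itv. Qed.

Lemma negative_growth_exponent : exists w M : R, [/\ w < 0, 0 < M &
  forall s t, s <= t -> (opnorm (U t s) <= (M * expR (w * (t - s)))%:E)%E].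
Proof.
have [_ [w [M M0 HM] <-]] := ereal_inf_lt U_stable.
by rewrite lte_fin => w0; exists w, M.
Qed.

(** Up to reflection, translation and scaling, this is the density of an
    exponential law. *)
Lemma integrable_exp_past (w t : R) : w < 0 ->
  lebesgue_measure.-integrable setT
    (fun r => (\1_(past t) r * expR (w * (t - r)))%:E).
Proof.
move=> w0; have nw : 0 < - w by rewrite oppr_gt0.
pose g (y : R) := (exponential_pdf (- w) y)%:E.
have mg : measurable_fun setT g.
  by apply/measurable_EFinP; exact: measurable_exponential_pdf.
have g0 y : (0 <= g y)%E by rewrite lee_fin exponential_pdf_ge0// ltW.
have mgN : measurable_fun setT (fun y : R => g (- y)).
  by apply: measurableT_comp => //; exact: oppr_measurable.
have E : (\int[lebesgue_measure]_r g (t - r)%R = 1)%E.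
  rewrite -(integral_exponential_pdf nw) -/g -(ge0_integral_opp mg g0).
  rewrite -[RHS](@ge0_integral_shift _ (fun y : R => g (- y)) (- t) mgN (fun y => g0 _)).
  by apply: eq_integral => r _; rewrite opprD opprK addrC.
have mgt : measurable_fun setT (fun r : R => g (t - r)).
  by apply: measurableT_comp => //; apply: measurable_funB.
have ig : lebesgue_measure.-integrable setT (fun r : R => g (t - r)).
  apply/integrableP; split => //.
  by under eq_integral do rewrite gee0_abs//; rewrite E ltry.
have := integrableZl measurableT (- w)^-1 ig; congr integrable.
apply/funext => r; rewrite /g -EFinM; congr EFin.
rewrite /exponential_pdf patchE indicE.
have -> : (t - r \in `[0, +oo[%classic) = (r \in past t).
  by apply/idP/idP; rewrite !inE /past/= !in_itv/= andbT subr_ge0.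
case: ifPn => _; last by rewrite mulr0 mul0r.
by rewrite mulKf ?gt_eqF// mul1r opprK.
Qed.

Lemma evolution_past_continuous (t : R) (y : X) :
  {within past t, continuous (fun r => U t r y)}.
Proof.
apply/subspace_continuousP => r0 /= r0t.
have /subspace_continuousP H := @evo_continuous R X D A U U_evolution y.
have r0t' : [set ts : R * R | ts.2 <= ts.1] (t, r0).
  by move: r0t; rewrite /past/= in_itv.
move=> P /(H _ r0t'); rewrite /nbhs /= /within/= => HP.
have [[P1 P2] /= [P1t P2r] P12] := HP.
move: P2r; apply: filterS => r /= P2r rt.
apply: (P12 (t, r)); first by split => //=; exact: nbhs_singleton.
by move: rt; rewrite /past/= in_itv.
Qed.

(** Writing K_x for this vector, the integrand of the covariance applied to x
    and paired with h is <K_x, K_h>: in this form it is measurable and, for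
    h = x, nonnegative. *)
Definition control_adjoint (t : R) (x : X) (r : R) : X :=
  adjoint ip (B r) (adjoint ip (U t r) x).

Lemma past_adjoint_measurable (t : R) (x : X) :
  measurable_fun setT
    ((fun r => \1_(past t) r *: adjoint ip (U t r) x) : R -> borel X).
Proof.
apply: (weak_borel_measurable ip_norm X_separable) => h.
have -> : (fun r => ip (\1_(past t) r *: adjoint ip (U t r) x) h) =
    (fun r => ip (U t r h) x) \_ (past t).
  apply/funext => r; rewrite (ipZl ip) patchE indicE.
  case: ifPn => [|_]; last by rewrite mul0r.
  rewrite inE /past/= in_itv/= => rt; rewrite mul1r ipC.
  by rewrite -(adjointP ip_norm (evo_bounded U_evolution rt)).
apply/(measurable_restrictT _ (mpast t)).
apply: subspace_continuous_measurable_fun => //.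
apply: (@within_continuous_comp X R R (past t) (fun r => U t r h) (fun y => ip y x)); last first.
  exact: evolution_past_continuous.
by move=> y _; exact: ip_continuous.
Qed.

(** B(r)^* is only weakly measurable in r, so it is moved to the other side of
    the scalar product, where B(r) h is Borel in r. *)
Lemma past_control_adjoint_measurable (t : R) (x : X) :
  measurable_fun setT
    ((fun r => \1_(past t) r *: control_adjoint t x r) : R -> borel X).
Proof.
apply: (weak_borel_measurable ip_norm X_separable) => h.
have -> : (fun r => ip (\1_(past t) r *: control_adjoint t x r) h) =
    (fun r => ip (\1_(past t) r *: adjoint ip (U t r) x) (B r h)).
  apply/funext => r; rewrite !(ipZl ip) /control_adjoint; congr (_ * _).
  by rewrite ipC -(adjointP ip_norm (B_operator r)) ipC.
apply: (ip_measurable2 ip_norm X_separable); first exact: past_adjoint_measurable.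
exact: B_measurable.
Qed.

Lemma control_ip (t : R) (x h : X) (r : R) : r <= t ->
  ip (U t r (B r (control_adjoint t x r))) h =
  ip (control_adjoint t x r) (control_adjoint t h r).
Proof.
move=> rt; rewrite (adjointP ip_norm (evo_bounded U_evolution rt)).
by rewrite (adjointP ip_norm (B_operator r)).
Qed.

Section Domain.
Variables (t : R) (I : set R).
Hypotheses (mI : measurable I) (It : I `<=` past t).

Let integrand x r : X := \1_I r *: U t r (B r (control_adjoint t x r)).

Let integrand_ip x h r : ip (integrand x r) h = \1_I r *
  ip (\1_(past t) r *: control_adjoint t x r) (\1_(past t) r *: control_adjoint t h r).
Proof.
rewrite /integrand (ipZl ip) indicE; have [Ir|] := boolP (r \in I); last by rewrite !mul0r.
have rt := It (set_mem Ir).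
rewrite control_ip; last by move: rt; rewrite /past/= in_itv.
by rewrite indicE mem_set// !scale1r.
Qed.

Let integrand_measurable x :
  measurable_fun setT (integrand x : measurableTypeR R -> borel X).
Proof.
apply: (weak_borel_measurable ip_norm X_separable) => h.
under eq_fun do rewrite integrand_ip.
apply: measurable_funM; first exact: measurable_indic.
by apply: (ip_measurable2 ip_norm X_separable);
  exact: past_control_adjoint_measurable.
Qed.

Let integrand_integrable x :
  lebesgue_measure.-integrable setT (fun r => (`|integrand x r|)%:E).
Proof.
have [w [M [w0 M0 HU]]] := negative_growth_exponent.
have [K HK] := B_bounded.
have K0 : 0 <= K by rewrite -lee_fin; exact: le_trans (opnorm_ge0 _) (HK 0).
have w2 : w *+ 2 < 0 by rewrite mulrn_wlt0.
have := integrableZl measurableT (M ^+ 2 * K ^+ 2 * `|x|)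
  (integrable_exp_past t w2).
apply: le_integrable => //.
  by apply/measurable_EFinP; apply: norm_measurable; exact: integrand_measurable.
move=> r _; rewrite -EFinM !abse_EFin lee_fin normr_id.
apply: le_trans (ler_norm _).
rewrite /integrand normrZ !indicE.
have [Ir|] := boolP (r \in I); last first.
  by move=> _; rewrite normr0 mul0r !mulr_ge0 ?expR_ge0 ?sqr_ge0 ?ler0n ?(ltW M0).
have rt := It (set_mem Ir); rewrite mem_set// normr1 !mul1r.
have rt' : r <= t by move: rt; rewrite /past/= in_itv.
have bU := evo_bounded U_evolution rt'.
have eU := HU _ _ rt'.
have e0 : 0 < M * expR (w * (t - r)) by rewrite mulr_gt0 ?expR_gt0.
apply: (le_trans (opnorm_le bU eU _)).
have -> : M ^+ 2 * K ^+ 2 * `|x| * expR (w *+ 2 * (t - r)) =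
    (M * expR (w * (t - r))) * (K * (K * ((M * expR (w * (t - r))) * `|x|))).
  by rewrite mulr2n mulrDl expRD; ring.
apply: ler_wpM2l; first exact: ltW.
apply: (le_trans (opnorm_le (B_operator r) (HK r) _)).
apply: ler_wpM2l => //.
apply: (le_trans (adjoint_le ip_norm (B_operator r) (HK r) _)).
by apply: ler_wpM2l => //; exact: (adjoint_le ip_norm bU eU).
Qed.

Lemma covariance_form x :
  (ip (covariance_on ip U B t I x) x)%:E =
  (\int[lebesgue_measure]_(r in I) (`|control_adjoint t x r| ^+ 2)%:E)%E.
Proof.
rewrite /covariance_on /bochner_on.
rewrite (ip_bochner ip_norm X_separable x (integrand_measurable x) (integrand_integrable x)).
have Ii := integrable_ip ip_norm x (integrand_measurable x) (integrand_integrable x).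
rewrite /Rintegral fineK; last by apply: integrable_fin_num.
rewrite [RHS]integral_mkcond; apply: eq_integral => r _.
rewrite patchE integrand_ip indicE; case: ifPn => Ir; last by rewrite mul0r.
have rt : (r \in past t) = true by apply/mem_set/It/set_mem.
by rewrite indicE rt !scale1r mul1r ip_norm.
Qed.

End Domain.

Lemma control_adjoint_comp s t r x : r <= s -> s <= t ->
  control_adjoint t x r = control_adjoint s (adjoint ip (U t s) x) r.
Proof.
move=> rs st; rewrite /control_adjoint; congr (adjoint _ _ _).
have rt := le_trans rs st.
apply: (adjointE ip_norm (evo_bounded U_evolution rt)) => y.
rewrite (evo_comp U_evolution y rs st).
rewrite (adjointP ip_norm (evo_bounded U_evolution st)).
by rewrite (adjointP ip_norm (evo_bounded U_evolution rs)).
Qed.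

Lemma covariance_ge0 t I x : measurable I -> I `<=` past t ->
  0 <= ip (covariance_on ip U B t I x) x.
Proof.
move=> mI It; rewrite -lee_fin covariance_form//.
by apply: integral_ge0 => r _; rewrite lee_fin sqr_ge0.
Qed.

(** For r <= s the flow property moves U(t,s) onto the vector, since the adjoint
    of U(t,r) = U(t,s) U(s,r) applies the adjoint of U(t,s) first; the part of
    the integral before s is thus a covariance at time s. *)
Lemma covariance_split s t x : s <= t ->
  ip (Qinf ip U B t x) x =
  ip (Qinf ip U B s (adjoint ip (U t s) x)) (adjoint ip (U t s) x) +
  ip (Qts ip U B t s x) x.
Proof.
move=> st; apply: EFin_inj; rewrite EFinD /Qinf /Qts.
have mst : measurable `[s, t] by exact: measurable_itv.
have sst : `[s, t] `<=` past t.
  by move=> r /=; rewrite /past/= !in_itv/= => /andP[].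
apply: (etrans (covariance_form (mpast t) (@subset_refl _ (past t)) x)); apply/esym.
apply: (etrans (congr2 adde (covariance_form (mpast s) (@subset_refl _ (past s)) _)
  (covariance_form mst sst x))); apply/esym.
set f := fun r => (`|control_adjoint t x r| ^+ 2)%:E.
have mf : measurable_fun (past t) f.
  apply/measurable_EFinP; apply/(measurable_restrictT _ (mpast t)).
  rewrite (_ : _ \_ _ = fun r => `|\1_(past t) r *: control_adjoint t x r| ^+ 2).
    apply: measurable_funX; apply: norm_measurable.
    exact: past_control_adjoint_measurable.
  apply/funext => r; rewrite patchE indicE; case: ifPn => _.
    by rewrite scale1r.
  by rewrite scale0r normr0 expr0n.
have E : past t = past s `|` `]s, t].
  apply/seteqP; split => r; rewrite /past/= !in_itv/=; have [rs|rs] := leP r s => //=.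
  - by left.
  - by right.
  - by move=> _; exact: le_trans st.
  - by case=> // /andP[].
have disj : [disjoint past s & `]s, t] ]%classic.
  apply/disj_setPS => r /= []; rewrite /past/= !in_itv/= => rs /andP[sr _].
  by move: sr; rewrite ltNge rs.
have mfE := mf; rewrite E in mfE.
rewrite E ge0_integral_setU//; last exact: mpast.
congr (_ + _)%E.
  apply: eq_integral => r; rewrite inE /past/= in_itv/= => rs.
  by rewrite /f (control_adjoint_comp x rs st).
apply: integral_itv_obnd_cbnd; apply: measurable_funS mf => //.
by move=> r /=; rewrite /past/= !in_itv/= => /andP[].
Qed.

End Covariance.

(** * The Gaussian measure as an image of a product *)

Section AffineMap.
Context (R : realType) (X : completeNormedModType R).
Variable ip : {dot X for @idfun R}.
Hypothesis ip_norm : forall x : X, ip x x = `|x| ^+ 2.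
Hypothesis X_separable : separable X.
Variable S : X -> X.
Hypothesis S_bounded : bounded_operator S.

Definition affine_map (xy : borel X * borel X) : borel X :=
  (S xy.1 + (xy.2 : X) : X).

Lemma affine_map_measurable : measurable_fun setT affine_map.
Proof.
apply: (weak_borel_measurable ip_norm X_separable) => h.
rewrite /affine_map; under eq_fun do rewrite (ipDl ip) (adjointP ip_norm S_bounded).
apply: measurable_funD.
  apply: (@measurableT_comp _ _ _ _ _ _ (fun x : borel X => ip x _)) => //.
  exact: (@ip_measurable R X ip ip_norm _ (borel X) id _ (@measurable_id _ _ _)).
apply: (@measurableT_comp _ _ _ _ _ _ (fun x : borel X => ip x h)) => //.
exact: (@ip_measurable R X ip ip_norm _ (borel X) id _ (@measurable_id _ _ _)).
Qed.

Variables (nu m0 m1 : probability (borel X) R).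

Lemma gaussian_marginal (m : probability (borel X) R) (Q : X -> X) (h : X)
    (g : R -> \bar R) :
  is_gaussian ip m 0 Q -> measurable_fun setT g -> (forall r, 0 <= g r)%E ->
  (\int[m]_x g (ip x h) = \int[centered_gaussian (ip (Q h) h)]_r g r)%E.
Proof.
move=> mG mg g0; pose L : borel X -> measurableTypeR R := fun x => ip x h.
have mL : measurable_fun setT L.
  exact: (@ip_measurable R X ip ip_norm _ (borel X) id _ (@measurable_id _ _ _)).
transitivity (\int[pushforward m L]_r g r)%E.
  by rewrite ge0_integral_pushforward.
apply: eq_measure_integral => A mA _.
by have := mG h A mA; rewrite (ip0l ip) real_gaussianE.
Qed.

(** The image of m0 (x) nu under (x, y) |-> S x + y has Gaussian marginals whose
    variances add up, so it is m1. *)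
Lemma gaussian_image (Q0 Qn Q1 : X -> X) :
  is_gaussian ip nu 0 Qn -> is_gaussian ip m0 0 Q0 -> is_gaussian ip m1 0 Q1 ->
  (forall h, 0 <= ip (Q0 h) h) -> (forall h, 0 <= ip (Qn h) h) ->
  (forall h, ip (Q1 h) h =
     ip (Q0 (adjoint ip S h)) (adjoint ip S h) + ip (Qn h) h) ->
  forall A, measurable A -> m1 A = (m0 \x nu)%E (affine_map @^-1` A).
Proof.
move=> gn g0 g1 Q0ge Qnge Qsplit.
pose mixin := isMeasurableFun.Build _ _ _ _ _ affine_map_measurable.
pose phi : {mfun (borel X * borel X)%type >-> borel X} := HB.pack affine_map mixin.
pose P : probability (borel X * borel X)%type R := (m0 \x nu)%E.
pose m2 : probability (borel X) R := distribution P phi.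
suff : forall A, measurable A -> m1 A = m2 A by [].
apply: (measure_eq_of_waves ip_norm X_separable) => h c.
have wint (m : probability (borel X) R) :
    (\int[m]_x (1 + wave ip h c x)%:E)%E = (1 + \int[m]_x wave ip h c x)%:E.
  have bw := bounded_measurable_integrable m (bounded_measurable_wave ip_norm h c).
  have b1 := bounded_measurable_integrable m (bounded_measurable_cst X (1 : R)).
  rewrite EFinD /Rintegral fineK; last by apply: integrable_fin_num.
  rewrite integralD_EFin// integral_cst//; congr (_ + _)%E.
  by rewrite mul1e; exact: probability_setT.
suff : (\int[m1]_x (1 + wave ip h c x)%:E = \int[m2]_x (1 + wave ip h c x)%:E)%E.
  by rewrite !wint => -[] /addrI.
pose g (r : R) := (1 + cos (r + c))%:E.
have mg : measurable_fun setT g.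
  apply/measurable_EFinP; apply: measurable_funD => //.
  apply: (@measurableT_comp _ _ _ _ _ _ (@cos R)); last exact: measurable_funD.
  by apply: continuous_measurable_fun; exact: continuous_cos.
have gge r : (0 <= g r)%E by rewrite lee_fin -lerBlDl sub0r cos_geN1.
have mgh : measurable_fun setT (fun x : borel X => g (ip x h)).
  apply: measurableT_comp => //.
  exact: (@ip_measurable R X ip ip_norm _ (borel X) id _ (@measurable_id _ _ _)).
rewrite -[LHS]/(\int[m1]_x g (ip x h))%E -[RHS]/(\int[m2]_x g (ip x h))%E.
rewrite (gaussian_marginal h g1 mg gge) Qsplit.
rewrite -(centered_gaussian_conv (Q0ge _) (Qnge h) mg gge).
have mgr (r : R) : measurable_fun setT (fun y : R => g (r + y)).
  by apply: measurableT_comp => //; exact: measurable_funD.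
transitivity (\int[m0]_x \int[nu]_y g (ip x (adjoint ip S h) + ip y h)%R)%E.
  have mG : measurable_fun setT (fun r : R =>
      \int[centered_gaussian (ip (Qn h) h)]_y g (r + y)%R)%E.
    pose G (xy : R * R) := g (xy.1 + xy.2).
    have mG : measurable_fun setT G.
      by apply: measurableT_comp => //; exact: measurable_funD.
    exact: (@measurable_fun_fubini_tonelli_F _ _ _ _ _
      (centered_gaussian (ip (Qn h) h)) G mG (fun xy => gge _)).
  rewrite -(gaussian_marginal (adjoint ip S h) g0 mG); last first.
    by move=> r; exact: integral_ge0.
  apply: eq_integral => x _.
  by rewrite -(gaussian_marginal h gn (mgr _) (fun r => gge _)).
rewrite ge0_integral_distribution//.
have mgphi : measurable_fun setT (fun xy => g (ip (affine_map xy) h)).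
  exact: (measurableT_comp mgh affine_map_measurable).
rewrite (@fubini_tonelli1 _ _ _ _ _ m0 nu (fun xy => g (ip (affine_map xy) h)))//.
apply: eq_integral => x _; apply: eq_integral => y _.
by rewrite /affine_map/= (ipDl ip) (adjointP ip_norm S_bounded).
Qed.

End AffineMap.

(** * Transfer of norms and null sets *)

Section LpNorm.
Context d (T : measurableType d) (R : realType).

(** Jensen's inequality for the powers, as Hölder's inequality against 1. *)
Lemma poweR_integral_le (m : probability T R) (g : T -> R) (p : R) :
  1 <= p -> measurable_fun setT g -> (forall x, 0 <= g x) ->
  ((\int[m]_x (g x)%:E) `^ p <= \int[m]_x ((g x) `^ p)%:E)%E.
Proof.
move=> p1 mg g0; have p0 : 0 < p by exact: lt_le_trans p1.
have I0 : (0 <= \int[m]_x (g x)%:E)%E by apply: integral_ge0 => x _; rewrite lee_fin.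
have [->|pN1] := eqVneq p 1.
  rewrite poweRe1//; apply: ge0_le_integral => //.
  - by move=> x _; rewrite lee_fin.
  - exact/measurable_EFinP.
  - apply/measurable_EFinP.
    by apply: (@measurableT_comp _ _ _ _ _ _ (@powR R ^~ 1)).
  - by move=> x _; rewrite powRr1.
have p1' : 1 < p by rewrite lt_neqAle eq_sym pN1.
pose q := p / (p - 1).
have q0 : 0 < q by rewrite divr_gt0// subr_gt0.
have pq : p^-1 + q^-1 = 1.
  by rewrite /q invf_div; field; rewrite gt_eqF.
have m1 : measurable_fun [set: T] (@cst _ R 1%R) by exact: measurable_cst.
have := @hoelder _ _ _ m g (cst 1) p q mg m1 p0 q0 pq.
have -> : (g \* cst 1)%R = g by apply/funext => x /=; rewrite mulr1.
have Nq : Lnorm m q%:E (EFin \o cst 1) = 1%E.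
  apply: etrans (Lnorm_cst1 m q) _; rewrite -[RHS](poweR1r q^-1).
  by congr (_ `^ _)%E; exact: probability_setT.
rewrite Nq mule1 Lnorm1.
under eq_integral do rewrite /= ger0_norm//.
move=> H; have := gt0_ler_poweR (ltW p0) _ _ H.
rewrite poweR_Lnorm ?gt_eqF// !in_itv/= !leey !andbT => /(_ I0 (Lnorm_ge0 _ _ _)).
move=> /le_trans; apply; apply: ge0_le_integral => //.
- by apply/measurable_EFinP; apply: (@measurableT_comp _ _ _ _ _ _ (@powR R ^~ p)) => //;
    exact: measurableT_comp.
- by apply/measurable_EFinP; apply: (@measurableT_comp _ _ _ _ _ _ (@powR R ^~ p)).
- by move=> x _; rewrite /= ger0_norm.
Qed.

End LpNorm.

Section LpNormX.
Context (R : realType) (X V : normedModType R).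

Lemma Lp_normE (m : {measure set (borel X) -> \bar R}) (p : R) (f : X -> V) :
  Lp_norm m p f = ((\int[m]_x (`|f x| `^ p)%:E) `^ p^-1)%E.
Proof.
rewrite /Lp_norm unlock; congr (_ `^ _)%E; apply: eq_integral => x _.
by rewrite /= normr_id.
Qed.

Lemma Lp_norm_integrable (m : probability (borel X) R) (p : R) (f : X -> V) :
  1 <= p -> measurable_fun setT (fun x : borel X => `|f x|) ->
  (Lp_norm m p f < +oo)%E -> m.-integrable setT (fun x => (`|f x|)%:E).
Proof.
move=> p1 mf; have p0 : 0 < p by exact: lt_le_trans p1.
rewrite Lp_normE => /lty_poweRy; rewrite invr_neq0 ?gt_eqF// => /(_ isT) fp.
apply/integrableP; split; first exact/measurable_EFinP.
under eq_integral do rewrite gee0_abs ?lee_fin//.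
apply: (@lty_poweRy _ _ p); first by rewrite gt_eqF.
by apply: le_lt_trans fp; apply: poweR_integral_le.
Qed.

End LpNormX.

Lemma Lp_scalarP (R : realType) (X : normedModType R)
    (m : {measure set (borel X) -> \bar R}) (p : R) (f : X -> R) :
  Lp_scalar m p f <->
  measurable_fun setT (f : borel X -> R) /\ (Lp_norm m p f < +oo)%E.
Proof.
have E : Lp_norm m p f = Lnorm m p%:E (EFin \o f).
  rewrite /Lp_norm -[RHS]Lnorm_abse; apply: eq_Lnorm => x //.
rewrite /Lp_scalar /= E; split.
  by move=> /andP[/[!inE]/= mf ff]; split.
by move=> [mf ff]; apply/andP; split; rewrite inE.
Qed.

Section Transition.
Context (R : realType) (X : completeNormedModType R).
Variable ip : {dot X for @idfun R}.
Hypothesis ip_norm : forall x : X, ip x x = `|x| ^+ 2.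
Hypothesis X_separable : separable X.
Variable S : X -> X.
Hypothesis S_bounded : bounded_operator S.
Variables (nu m0 m1 : probability (borel X) R).
Hypothesis m1_image : forall A, measurable A ->
  m1 A = (m0 \x nu)%E (affine_map S @^-1` A).

Let phi := affine_map S.
Let mphi : measurable_fun setT phi.
Proof. exact: (affine_map_measurable ip_norm X_separable S_bounded). Qed.

Lemma shift_measurable d (Y : measurableType d) (f : X -> Y) x :
  measurable_fun setT (f : borel X -> Y) ->
  measurable_fun setT (fun y : borel X => f (S x + (y : X))%R).
Proof.
move=> mf; apply: (measurableT_comp (f := f : borel X -> Y)) => //.
exact: (measurableT_comp mphi (measurable_pair1 (x : borel X))).
Qed.

Lemma ge0_integral_image (f : X -> \bar R) :
  measurable_fun setT (f : borel X -> \bar R) -> (forall x, 0 <= f x)%E ->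
  (\int[m1]_x f x = \int[m0]_x \int[nu]_y f (S x + (y : X))%R)%E.
Proof.
move=> mf f0.
transitivity (\int[pushforward (m0 \x nu) phi]_x f x)%E.
  by apply: eq_measure_integral => A mA _; exact: m1_image.
rewrite ge0_integral_pushforward//.
rewrite (@fubini_tonelli1 _ _ _ _ _ m0 nu (f \o phi))//.
  exact: (measurableT_comp (f := f : borel X -> \bar R)).
by move=> xy; exact: f0.
Qed.

Lemma image_integrable (f : X -> R) :
  m1.-integrable setT (fun x : borel X => (f x)%:E) ->
  (m0 \x nu)%E.-integrable setT (fun xy => (f (phi xy))%:E).
Proof.
move=> /integrableP[mf foo]; apply/integrableP; split.
  exact: (measurableT_comp (f := (fun x : borel X => (f x)%:E))).
rewrite (@fubini_tonelli1 _ _ _ _ _ m0 nu (fun xy => `|(f (phi xy))%:E|%E))//; last first.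
  apply: measurableT_comp => //.
  exact: (measurableT_comp (f := (fun x : borel X => (f x)%:E))).
rewrite -(@ge0_integral_image (fun x => `|(f x)%:E|%E))//.
exact: measurableT_comp.
Qed.

Lemma integral_image (f : X -> R) :
  m1.-integrable setT (fun x : borel X => (f x)%:E) ->
  (\int[m1]_x (f x)%:E = \int[m0]_x \int[nu]_y (f (S x + (y : X))%R)%:E)%E.
Proof.
move=> fi; have := image_integrable fi => fpi.
transitivity (\int[pushforward (m0 \x nu) phi]_x (f x)%:E)%E.
  by apply: eq_measure_integral => A mA _; exact: m1_image.
rewrite integral_pushforward//; last by case/integrableP : fi.
by rewrite -(integral12_prod_meas1 fpi).
Qed.

Section Norms.
Variable V : normedModType R.
Implicit Types f Tf : X -> V.

Definition mean_norm f (x : X) : \bar R := (\int[nu]_y (`|f (S x + (y : X))%R|)%:E)%E.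

Let norm_meas f := measurable_fun setT (fun x : borel X => `|f x|).

Lemma mean_norm_ge0 f x : (0 <= mean_norm f x)%E.
Proof. by apply: integral_ge0 => y _; rewrite lee_fin. Qed.

Lemma mean_norm_measurable f : norm_meas f ->
  measurable_fun setT (mean_norm f : borel X -> \bar R).
Proof.
move=> mf; apply: (@measurable_fun_fubini_tonelli_F _ _ _ _ _ nu
  (fun xy => (`|f (phi xy)|)%:E)) => //.
by apply/measurable_EFinP; exact: (measurableT_comp (f := fun x : borel X => `|f x|)).
Qed.

(** This is where finiteness for almost every x comes from: a function that is
    integrable for m1 has integrable translates for m0-almost every x. *)
Lemma integral_mean_norm f : norm_meas f ->
  (\int[m0]_x mean_norm f x = \int[m1]_x (`|f x|)%:E)%E.
Proof.
move=> mf; rewrite (@ge0_integral_image (fun x => (`|f x|)%:E))//.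
exact/measurable_EFinP.
Qed.

Lemma ae_mean_norm_lty f : norm_meas f ->
  m1.-integrable setT (fun x => (`|f x|)%:E) ->
  {ae m0, forall x, (mean_norm f x < +oo)%E}.
Proof.
move=> mf /integrableP[_ foo].
have /integrable_ae : m0.-integrable setT (mean_norm f : borel X -> \bar R).
  apply/integrableP; split; first exact: mean_norm_measurable.
  under eq_integral do rewrite gee0_abs ?mean_norm_ge0//.
  rewrite integral_mean_norm//; move: foo.
  by under eq_integral do rewrite gee0_abs ?lee_fin//.
move=> /(_ measurableT); apply: filterS => x /= /(_ Logic.I).
by rewrite ge0_fin_numE ?mean_norm_ge0.
Qed.

(** Only the domination of |Tf| by the averaged norm matters, so that one
    argument serves the scalar and the vector operator. *)
Lemma mean_norm_contraction f Tf (p : R) : 1 <= p -> norm_meas f -> norm_meas Tf ->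
  (forall x, (`|Tf x|)%:E <= mean_norm f x)%E ->
  (Lp_norm m0 p Tf <= Lp_norm m1 p f)%E.
Proof.
move=> p1 mf mTf dom; have p0 : 0 < p by exact: lt_le_trans p1.
have mpow g : measurable_fun setT (g : borel X -> R) ->
    measurable_fun setT (fun x : borel X => ((g x) `^ p)%:E).
  by move=> mg; apply/measurable_EFinP;
    apply: (@measurableT_comp _ _ _ _ _ _ (@powR R ^~ p)).
rewrite !Lp_normE; apply: gt0_ler_poweR.
- by rewrite invr_ge0 ltW.
- by rewrite in_itv/= leey andbT integral_ge0// => x _; rewrite lee_fin powR_ge0.
- by rewrite in_itv/= leey andbT integral_ge0// => x _; rewrite lee_fin powR_ge0.
rewrite (@ge0_integral_image (fun x => (`|f x| `^ p)%:E)); last 2 first.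
- exact: mpow.
- by move=> x; rewrite lee_fin powR_ge0.
apply: ge0_le_integral => //.
- exact: mpow.
- apply: (@measurable_fun_fubini_tonelli_F _ _ _ _ _ nu
    (fun xy => (`|f (phi xy)| `^ p)%:E)) => [|xy]; last by rewrite lee_fin powR_ge0.
  exact: (measurableT_comp (f := fun x : borel X => (`|f x| `^ p)%:E) (mpow _ mf)).
move=> x _; rewrite -poweR_EFin.
apply: (@le_trans _ _ (mean_norm f x `^ p)%E).
  apply: gt0_ler_poweR; first exact: ltW.
  - by rewrite in_itv/= leey andbT lee_fin.
  - by rewrite in_itv/= leey andbT mean_norm_ge0.
  exact: dom.
apply: (@poweR_integral_le _ _ _ nu (fun y : borel X => `|f (S x + (y : X))%R|)) => //.
exact: (shift_measurable (f := fun x => `|f x|)).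
Qed.

(** The indicator of an m1-null set integrates to 0, so by the change of
    variables its translates are nu-null for m0-almost every x. *)
Lemma ae_image (P : X -> Prop) : {ae m1, forall x, P x} ->
  {ae m0, forall x : borel X, {ae nu, forall y : borel X, P (S x + (y : X))%R}}.
Proof.
move=> [N [mN N0 PN]].
have m1N : (\int[m0]_x \int[nu]_y (\1_N (S x + (y : X))%R)%:E = 0)%E.
  rewrite -(@ge0_integral_image (fun x => (\1_N x)%:E))//; last first.
    by apply/measurable_EFinP; exact: measurable_indic.
  by rewrite integral_indic// setIT.
have mI : measurable_fun setT (fun x : borel X => \int[nu]_y (\1_N (S x + (y : X))%R)%:E)%E.
  apply: (@measurable_fun_fubini_tonelli_F _ _ _ _ _ nu
    (fun xy => (\1_N (phi xy))%:E)) => //.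
  apply/measurable_EFinP.
  exact: (measurableT_comp (measurable_indic mN) mphi).
have I0 x : (0 <= \int[nu]_y (\1_N (S x + (y : X))%R)%:E)%E.
  by apply: integral_ge0 => y _; rewrite lee_fin.
have /(ae_eq_integral_abs m0 measurableT mI) : (\int[m0]_x
    `|\int[nu]_y (\1_N (S x + (y : X))%R)%:E| = 0)%E.
  by under eq_integral do rewrite gee0_abs//.
apply: filterS => x /= /(_ Logic.I) Hx.
have mNx : measurable [set y : borel X | N (S x + (y : X))%R].
  rewrite -[X in measurable X]setTI.
  exact: (shift_measurable (f := (id : X -> borel X)) x (@measurable_id _ _ _)).
exists [set y : borel X | N (S x + (y : X))%R]; split => //.
- rewrite -[[set _ | _]]setIT -(integral_indic nu measurableT mNx) -[RHS]Hx.
  by apply: eq_integral => y _; rewrite !indicE; congr (_%:R)%:E; congr nat_of_bool;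
    apply/idP/idP; rewrite !inE.
- by move=> y /= nPy; apply: PN.
Qed.

End Norms.

End Transition.

(** * The transition operators on bounded continuous functions and on scalar functions *)

Section BochnerNorm.
Context (R : realType) (X : completeNormedModType R).
Variable ip : {dot X for @idfun R}.
Hypothesis ip_norm : forall x : X, ip x x = `|x| ^+ 2.
Hypothesis X_separable : separable X.
Context d (T : measurableType d).
Variable mu : {measure set T -> \bar R}.

Lemma norm_bochner_le (f : T -> X) :
  measurable_fun setT (f : T -> borel X) ->
  mu.-integrable setT (fun x => (`|f x|)%:E) ->
  ((`|bochner mu f|)%:E <= \int[mu]_x (`|f x|)%:E)%E.
Proof.
move=> mf intf; set v := bochner mu f.
have [->|v0] := eqVneq v 0.
  by rewrite normr0; apply: integral_ge0 => x _; rewrite lee_fin.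
have nv : 0 < `|v| by rewrite normr_gt0.
rewrite -(fineK (integrable_fin_num measurableT intf)) lee_fin -(ler_pM2r nv).
rewrite -expr2 -ip_norm {1}/v (ip_bochner ip_norm X_separable v mf intf).
have Iv := integrable_ip ip_norm v mf intf.
rewrite -[leRHS]/((\int[mu]_x `|f x|) * `|v|) -RintegralZr//.
apply: le_Rintegral => //; first exact: (integrableZr measurableT `|v| intf).
by move=> x _; rewrite (le_trans (ler_norm _))// (cauchy_schwarz ip_norm).
Qed.

Lemma bochnerB (f g : T -> X) :
  measurable_fun setT (f : T -> borel X) ->
  mu.-integrable setT (fun x => (`|f x|)%:E) ->
  measurable_fun setT (g : T -> borel X) ->
  mu.-integrable setT (fun x => (`|g x|)%:E) ->
  [/\ measurable_fun setT ((fun x => f x - g x) : T -> borel X),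
      mu.-integrable setT (fun x => (`|f x - g x|)%:E) &
      bochner mu (fun x => f x - g x) = bochner mu f - bochner mu g].
Proof.
move=> mf intf mg intg.
have mfg : measurable_fun setT ((fun x => f x - g x) : T -> borel X).
  apply: (weak_borel_measurable ip_norm X_separable) => h.
  under eq_fun do rewrite (ipBl ip).
  by apply: measurable_funB; exact: ip_measurable.
have intfg : mu.-integrable setT (fun x => (`|f x - g x|)%:E).
  have := integrableD measurableT intf intg; apply: le_integrable => //.
    by apply/measurable_EFinP; exact: norm_measurable.
  move=> x _; rewrite !abse_EFin lee_fin normr_id.
  by rewrite (le_trans (ler_normB _ _))// ler_norm.
split => //; apply: (ip_inj ip_norm) => h.
apply: (etrans (ip_bochner ip_norm X_separable h mfg intfg)); apply/esym.
apply: (etrans (ipBl ip _ _ _)).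
apply: (etrans (congr2 (fun u v => u - v)
  (ip_bochner ip_norm X_separable h mf intf)
  (ip_bochner ip_norm X_separable h mg intg))).
rewrite -RintegralB//; last 2 first.
- exact: integrable_ip.
- exact: integrable_ip.
by apply: eq_Rintegral => x _; rewrite (ipBl ip).
Qed.

End BochnerNorm.

Lemma bounded_funP (R : realType) (X V : normedModType R) (f : X -> V) :
  bounded_fun f <-> exists C : R, forall x, `|f x| <= C.
Proof.
split=> [[M [_ HM]]|[C HC]].
  by exists (M + 1) => x; apply: HM => //; rewrite ltrDl.
exists C; split; first exact: num_real.
by move=> M CM x _; exact: le_trans (HC x) (ltW CM).
Qed.

Section Operators.
Context (R : realType) (X : completeNormedModType R).
Variable ip : {dot X for @idfun R}.
Hypothesis ip_norm : forall x : X, ip x x = `|x| ^+ 2.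
Hypothesis X_separable : separable X.
Variable S : X -> X.
Hypothesis S_bounded : bounded_operator S.
Variable nu : probability (borel X) R.

Let Sc : continuous S. Proof. exact: bounded_operator_continuous. Qed.

Let translate_continuous (V : normedModType R) (f : X -> V) x :
  continuous f -> continuous (fun y => f (S x + y)).
Proof.
move=> cf y; apply: (@continuous_comp _ _ _ (fun y => S x + y) f); last exact: cf.
by apply: cvgD; [exact: cvg_cst|exact: cvg_id].
Qed.

(** Dominated convergence along a sequence that would contradict continuity;
    the bound on increments holds for both the scalar and the vector operator. *)
Lemma transition_continuous (V : normedModType R) (f Pf : X -> V) :
  Cb f ->
  (forall x x', (`|Pf x - Pf x'|)%:E <=
     \int[nu]_y (`|f (S x + (y : X))%R - f (S x' + (y : X))%R|)%:E)%E ->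
  continuous Pf.
Proof.
move=> [cf /bounded_funP[C fC]] dom x; apply/cvgrPdist_le => e e0.
apply: contrapT => nH.
have /choice[u uP] (n : nat) :
    exists x', `|x - x'| < n.+1%:R^-1 /\ e < `|Pf x - Pf x'|.
  apply: contrapT => H; apply: nH.
  have n0 : 0 < n.+1%:R^-1 :> R by rewrite invr_gt0.
  have nx : \forall x' \near x, `|x - x'| < n.+1%:R^-1 :> R.
    exact: cvgr_dist_lt.
  apply: filterS nx => x' xx'; rewrite leNgt; apply/negP => ex'.
  by apply: H; exists x'.
have ux : u n @[n --> \oo] --> x.
  apply/cvgrPdist_lt => d d0.
  have [N _ HN] := near_infty_natSinv_lt (PosNum d0).
  by exists N => // n /HN /=; apply: lt_trans; exact: (uP n).1.
have I0 : (\int[nu]_y (`|f (S x + (y : X))%R - f (S (u n) + (y : X))%R|)%:E)%E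
    @[n --> \oo] --> (0 : \bar R)%E.
  rewrite -[X in _ --> X](@integral0 _ _ _ nu setT).
  apply: (@dominated_cvg _ _ _ nu setT measurableT _ _ (fun=> (C + C)%:E)) => //.
  - move=> n; apply/measurable_EFinP; apply: continuous_borel_real => y.
    apply: cvg_norm; apply: cvgB; exact: translate_continuous.
  - move=> y _; apply: cvg_EFin; first exact: nearW.
    rewrite -(normr0 V); apply: cvg_norm.
    rewrite -(subrr (f (S x + (y : X)))); apply: cvgB; first exact: cvg_cst.
    have uy : S (u n) + y @[n --> \oo] --> S x + y.
      by apply: cvgD; [exact: (cvg_comp _ _ ux (@Sc x))|exact: cvg_cst].
    exact: (cvg_comp _ _ uy (cf _)).
  - apply: (@bounded_measurable_integrable R X nu (fun=> C + C)).
    exact: bounded_measurable_cst.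
  - move=> n y _; rewrite abse_EFin lee_fin normr_id.
    by rewrite (le_trans (ler_normB _ _))// lerD.
have /fine_cvgP[fin cv] := I0.
have [N _ HN] := cvgr_lt _ cv _ e0.
have [N' _ HN'] := fin.
pose n := maxn N N'.
have := dom x (u n); rewrite -(fineK (HN' n (leq_maxr _ _))) lee_fin.
have := (uP n).2; have /= := HN n (leq_maxl _ _).
by move=> H1 H2 H3; have := lt_trans (lt_le_trans H2 H3) H1; rewrite ltxx.
Qed.

Lemma Cb_integrable (V : normedModType R) (f : X -> V) x : Cb f ->
  nu.-integrable setT (fun y : borel X => (`|f (S x + (y : X))%R|)%:E).
Proof.
move=> [cf /bounded_funP[C fC]].
apply: (@bounded_measurable_integrable R X nu (fun y => `|f (S x + y)|)); split.
  apply: continuous_borel_real => y; apply: cvg_norm.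
  exact: translate_continuous.
by exists C => y; rewrite normr_id.
Qed.

Lemma Cb_mean_norm_lty (V : normedModType R) (f : X -> V) x : Cb f ->
  (mean_norm S nu f x < +oo)%E.
Proof.
move=> Cf; have /integrableP[_] := Cb_integrable x Cf.
by under eq_integral do rewrite gee0_abs ?lee_fin//.
Qed.

Lemma Pscalar_Cb (f : X -> R) : Cb f -> Cb (Pscalar S nu f).
Proof.
move=> Cf; have [cf /bounded_funP[C fC]] := Cf.
have If x : nu.-integrable setT (fun y : borel X => (f (S x + (y : X))%R)%:E).
  apply: (@bounded_measurable_integrable R X nu (fun y => f (S x + y))); split.
    by apply: continuous_borel_real; exact: translate_continuous.
  by exists C => y.
split.
  apply: (transition_continuous Cf) => x x'.
  rewrite /Pscalar -RintegralB//; [|exact: If|exact: If].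
  rewrite (EFin_normr_Rintegral measurableT (integrableB measurableT (If x) (If x'))).
  apply: (le_trans (le_abse_integral _ _ _)) => //.
  by case/integrableP : (integrableB measurableT (If x) (If x')).
apply/bounded_funP; exists C => x; rewrite /Pscalar -lee_fin.
rewrite (EFin_normr_Rintegral measurableT (If x)).
apply: (le_trans (le_abse_integral _ _ _)) => //; first by case/integrableP : (If x).
apply: (@le_trans _ _ (\int[nu]_y (cst C%:E y))%E).
  apply: ge0_le_integral => //.
  - by apply: measurableT_comp => //; case/integrableP : (If x).
  - by move=> y _; rewrite abse_EFin lee_fin.
by rewrite integral_cst// [X in (_ * X)%E](_ : _ = 1%E) ?mule1//; exact: probability_setT.
Qed.

Lemma translate_borel (F : X -> X) x : measurable_fun setT (F : borel X -> borel X) ->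
  measurable_fun setT ((fun y => F (S x + (y : X))) : borel X -> borel X).
Proof. exact: (shift_measurable ip_norm X_separable S_bounded (f := F : X -> borel X)). Qed.

Lemma Pvector_Cb (F : X -> X) : Cb F -> Cb (Pvector S nu F).
Proof.
move=> CF; have [cF /bounded_funP[C FC]] := CF.
have mF x := translate_borel x (continuous_borel cF).
have IF x := Cb_integrable x CF.
split.
  apply: (transition_continuous CF) => x x'.
  have [mB IB <-] := bochnerB ip_norm X_separable (mF x) (IF x) (mF x') (IF x').
  exact: (norm_bochner_le ip_norm X_separable mB IB).
apply/bounded_funP; exists C => x; rewrite /Pvector -lee_fin.
apply: (le_trans (norm_bochner_le ip_norm X_separable (mF x) (IF x))).
apply: (@le_trans _ _ (\int[nu]_y (cst C%:E y))%E).
  apply: ge0_le_integral => //.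
  - by case/integrableP : (IF x).
  - by move=> y _; rewrite lee_fin.
by rewrite integral_cst// [X in (_ * X)%E](_ : _ = 1%E) ?mule1//; exact: probability_setT.
Qed.

Variables (m0 m1 : probability (borel X) R).
Hypothesis m1_image : forall A, measurable A ->
  m1 A = (m0 \x nu)%E (affine_map S @^-1` A).

Let mtr (f : X -> R) x : measurable_fun setT (f : borel X -> R) ->
  measurable_fun setT (fun y : borel X => f (S x + (y : X))).
Proof. exact: shift_measurable. Qed.

Lemma Pscalar_integrable (f : X -> R) x :
  measurable_fun setT (f : borel X -> R) -> (mean_norm S nu f x < +oo)%E ->
  nu.-integrable setT (fun y : borel X => (f (S x + (y : X))%R)%:E).
Proof.
move=> mf fx; apply/integrableP; split; last exact: fx.
by apply/measurable_EFinP; exact: mtr.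
Qed.

Lemma Pscalar_norm_le (f : X -> R) x : measurable_fun setT (f : borel X -> R) ->
  ((`|Pscalar S nu f x|)%:E <= mean_norm S nu f x)%E.
Proof.
move=> mf; have [fx|] := ltP (mean_norm S nu f x) +oo%E; last first.
  by rewrite leye_eq => /eqP ->; rewrite leey.
have If := Pscalar_integrable mf fx.
rewrite (EFin_normr_Rintegral measurableT If).
by apply: (le_trans (le_abse_integral _ _ _)) => //; case/integrableP : If.
Qed.

Lemma Pscalar_measurable (f : X -> R) : measurable_fun setT (f : borel X -> R) ->
  measurable_fun setT (Pscalar S nu f : borel X -> R).
Proof.
move=> mf; apply: (measurableT_comp (f := fine)) => //.
have mphi := affine_map_measurable ip_norm X_separable S_bounded.
have mg : measurable_fun setT (fun xy => (f (affine_map S xy))%:E).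
  by apply/measurable_EFinP; exact: (measurableT_comp (f := f : borel X -> R)).
pose g xy := (f (affine_map S xy))%:E.
have -> : (fun x => \int[nu]_y (f (S x + (y : X))%R)%:E)%E =
    (fun x => \int[nu]_y g^\+ (x, y) - \int[nu]_y g^\- (x, y))%E.
  apply/funext => x; rewrite [LHS]integralE; congr (_ - _)%E; apply: eq_integral => y _.
    by rewrite !funeposE.
  by rewrite !funenegE.
apply: emeasurable_funB.
  by apply: (@measurable_fun_fubini_tonelli_F _ _ _ _ _ nu (g^\+)%E) => //;
    exact: measurable_funepos.
by apply: (@measurable_fun_fubini_tonelli_F _ _ _ _ _ nu (g^\-)%E) => //;
  exact: measurable_funeneg.
Qed.

Lemma Pscalar_integral (f : X -> R) :
  m1.-integrable setT (fun x : borel X => (f x)%:E) ->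
  \int[m0]_x Pscalar S nu f x = \int[m1]_x f x.
Proof.
move=> If; have mf : measurable_fun setT (f : borel X -> R).
  by apply/measurable_EFinP; case/integrableP : If.
rewrite [RHS]/Rintegral (integral_image ip_norm X_separable S_bounded m1_image If).
congr fine; apply: ae_eq_integral => //.
- by apply/measurable_EFinP; exact: Pscalar_measurable.
- exact: (measurable_fubini_F
    (image_integrable ip_norm X_separable S_bounded m1_image If)).
have In : m1.-integrable setT (fun x : borel X => (`|f x|)%:E).
  exact: integrable_norm If.
have mn : measurable_fun setT (fun x : borel X => `|f x|) by exact: measurableT_comp.
have := ae_mean_norm_lty ip_norm X_separable S_bounded m1_image mn In.
apply: (@filterS _ _ (ae_filter_ringOfSetsType m0)) => x fx _; rewrite /Pscalar /Rintegral fineK//.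
by apply: integrable_fin_num => //; exact: Pscalar_integrable.
Qed.

Lemma Pscalar_ae (f g : X -> R) :
  measurable_fun setT (f : borel X -> R) -> measurable_fun setT (g : borel X -> R) ->
  {ae m1, forall x, f x = g x} ->
  {ae m0, forall x, Pscalar S nu f x = Pscalar S nu g x}.
Proof.
move=> mf mg /(ae_image ip_norm X_separable S_bounded m1_image).
apply: filterS => x fgx; congr fine; apply: ae_eq_integral => //.
- by apply/measurable_EFinP; exact: mtr.
- by apply/measurable_EFinP; exact: mtr.
by apply: filterS fgx => y fgy _; rewrite fgy.
Qed.

End Operators.

(** * The vector-valued operator and the proof *)

Section Extensions.
Context (R : realType) (X : completeNormedModType R).
Variable ip : {dot X for @idfun R}.
Hypothesis ip_norm : forall x : X, ip x x = `|x| ^+ 2.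
Hypothesis X_separable : separable X.
Variable S : X -> X.
Hypothesis S_bounded : bounded_operator S.
Variables (nu m0 m1 : probability (borel X) R).
Hypothesis m1_image : forall A, measurable A ->
  m1 A = (m0 \x nu)%E (affine_map S @^-1` A).
Variable p : R.
Hypothesis p1 : 1 <= p.

Let mnorm (V : normedModType R) (f : X -> V) :=
  measurable_fun setT (fun x : borel X => `|f x|).

Lemma Pscalar_extension :
  bounded_extension m1 m0 p (Lp_scalar m1 p) (Lp_scalar m0 p)
    (Pscalar S nu) (Pscalar S nu) /\
  contraction_Lp m1 m0 p (Lp_scalar m1 p) (Pscalar S nu).
Proof.
have contr : contraction_Lp m1 m0 p (Lp_scalar m1 p) (Pscalar S nu).
  move=> f /Lp_scalarP[mf ff].
  apply: (mean_norm_contraction ip_norm X_separable S_bounded m1_image p1).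
  - exact: measurableT_comp.
  - apply: measurableT_comp => //.
    exact: (Pscalar_measurable ip_norm X_separable S_bounded).
  - by move=> x; exact: (Pscalar_norm_le ip_norm X_separable S_bounded).
split=> //; split.
- exact: Pscalar_Cb.
- move=> f Lf; have [mf ff] := (Lp_scalarP _ _ _).1 Lf; apply/Lp_scalarP; split.
    exact: (Pscalar_measurable ip_norm X_separable S_bounded).
  exact: le_lt_trans (contr f Lf) ff.
- move=> f g /Lp_scalarP[mf _] /Lp_scalarP[mg _].
  exact: (Pscalar_ae ip_norm X_separable S_bounded m1_image).
- move=> a f g /Lp_scalarP[mf ff] /Lp_scalarP[mg fg].
  have nf : mnorm f by exact: measurableT_comp.
  have ng : mnorm g by exact: measurableT_comp.
  have := ae_mean_norm_lty ip_norm X_separable S_bounded m1_image nf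
    (Lp_norm_integrable p1 nf ff).
  have := ae_mean_norm_lty ip_norm X_separable S_bounded m1_image ng
    (Lp_norm_integrable p1 ng fg).
  apply: (@filterS2 _ _ (ae_filter_ringOfSetsType m0)) => x gx fx.
  have If := Pscalar_integrable ip_norm X_separable S_bounded mf fx.
  have Ig := Pscalar_integrable ip_norm X_separable S_bounded mg gx.
  rewrite /Pscalar -[a *: _]/(a * _) -RintegralZl// -RintegralD//.
  exact: (integrableZl measurableT a If).
- by exists 1 => f Lf; rewrite mul1e; exact: contr.
- by move=> f _; apply: aeW.
Qed.

(** Cutting off at the points where the translate is not integrable makes the
    scalar products with a fixed vector explicit everywhere, hence measurable. *)
Definition vector_transition (F : X -> X) (x : X) : X :=
  if (mean_norm S nu F x < +oo)%E then Pvector S nu F x else 0.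

Lemma vector_transition_ip (F : X -> X) h x :
  measurable_fun setT (F : borel X -> borel X) ->
  ip (vector_transition F x) h =
  if (mean_norm S nu F x < +oo)%E then Pscalar S nu (fun z => ip (F z) h) x else 0.
Proof.
move=> mF; rewrite /vector_transition; case: ifPn => [Fx|_]; last exact: ip0l.
have mFx := translate_borel ip_norm X_separable S_bounded x mF.
rewrite /Pvector (ip_bochner ip_norm X_separable h mFx)//.
apply/integrableP; split.
  by apply/measurable_EFinP; exact: norm_measurable.
by under eq_integral do rewrite gee0_abs ?lee_fin//.
Qed.

Lemma vector_transition_measurable (F : X -> X) :
  measurable_fun setT (F : borel X -> borel X) ->
  measurable_fun setT (vector_transition F : borel X -> borel X).
Proof.
move=> mF; apply: (weak_borel_measurable ip_norm X_separable) => h.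
under eq_fun do rewrite vector_transition_ip//.
apply: measurable_fun_ifT => //.
  apply: measurable_fun_lte => //.
  apply: (mean_norm_measurable ip_norm X_separable S_bounded).
  exact: (@norm_measurable R X _ (borel X) F).
apply: (Pscalar_measurable ip_norm X_separable S_bounded).
exact: (@ip_measurable R X ip ip_norm _ (borel X) F).
Qed.

Lemma vector_transition_norm_le (F : X -> X) x :
  measurable_fun setT (F : borel X -> borel X) ->
  ((`|vector_transition F x|)%:E <= mean_norm S nu F x)%E.
Proof.
move=> mF; rewrite /vector_transition; case: ifPn => [Fx|_]; last first.
  by rewrite normr0 mean_norm_ge0.
have mFx := translate_borel ip_norm X_separable S_bounded x mF.
apply: (norm_bochner_le ip_norm X_separable mFx); apply/integrableP; split.
  by apply/measurable_EFinP; exact: norm_measurable.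
by under eq_integral do rewrite gee0_abs ?lee_fin//.
Qed.

Lemma vector_extension :
  bounded_extension m1 m0 p (Lp_vector m1 p) (Lp_vector m0 p)
    (Pvector S nu) vector_transition /\
  contraction_Lp m1 m0 p (Lp_vector m1 p) vector_transition.
Proof.
have mN (F : X -> X) : measurable_fun setT (F : borel X -> borel X) -> mnorm F.
  by move=> mF; exact: (@norm_measurable R X _ (borel X) F).
have fin (F : X -> X) : Lp_vector m1 p F ->
    {ae m0, forall x, (mean_norm S nu F x < +oo)%E}.
  move=> [mF fF]; apply: (ae_mean_norm_lty ip_norm X_separable S_bounded m1_image (mN _ mF)).
  exact: (Lp_norm_integrable p1 (mN _ mF) fF).
have contr : contraction_Lp m1 m0 p (Lp_vector m1 p) vector_transition.
  move=> F [mF fF].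
  apply: (mean_norm_contraction ip_norm X_separable S_bounded m1_image p1).
  - exact: mN.
  - by apply: mN; exact: vector_transition_measurable.
  - by move=> x; exact: vector_transition_norm_le.
split=> //; split.
- exact: (Pvector_Cb ip_norm X_separable S_bounded).
- move=> F [mF fF]; split; first exact: vector_transition_measurable.
  exact: le_lt_trans (contr F (conj mF fF)) fF.
- move=> F G [mF fF] [mG fG] /(ae_image ip_norm X_separable S_bounded m1_image).
  apply: filterS => x FGx; apply: (ip_inj ip_norm) => h.
  apply: (etrans (vector_transition_ip h x mF)); apply/esym.
  apply: (etrans (vector_transition_ip h x mG)); apply/esym.
  have -> : mean_norm S nu F x = mean_norm S nu G x.
    apply: ge0_ae_eq_integral => //.
    + apply/measurable_EFinP; apply: norm_measurable.
      exact: (translate_borel ip_norm X_separable S_bounded x mF).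
    + apply/measurable_EFinP; apply: norm_measurable.
      exact: (translate_borel ip_norm X_separable S_bounded x mG).
    + by apply: filterS FGx => y ->.
  case: ifP => // _; congr fine; apply: ae_eq_integral => //.
  + apply/measurable_EFinP; apply: (ip_measurable ip_norm).
    exact: (translate_borel ip_norm X_separable S_bounded x mF).
  + apply/measurable_EFinP; apply: (ip_measurable ip_norm).
    exact: (translate_borel ip_norm X_separable S_bounded x mG).
  by apply: filterS FGx => y ->.
- move=> a F G LF LG; have [[mF fF] [mG fG]] := (LF, LG).
  have := fin _ LG; have := fin _ LF.
  apply: (@filterS2 _ _ (ae_filter_ringOfSetsType m0)) => x Fx Gx.
  have mH : measurable_fun setT ((fun y => a *: F y + G y) : borel X -> borel X).
    apply: (weak_borel_measurable ip_norm X_separable) => h.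
    under eq_fun do rewrite (ipDl ip) (ipZl ip).
    apply: measurable_funD; last exact: (@ip_measurable R X ip ip_norm _ (borel X) G).
    by apply: measurable_funM => //; exact: (@ip_measurable R X ip ip_norm _ (borel X) F).
  have mFx := translate_borel ip_norm X_separable S_bounded x mF.
  have mGx := translate_borel ip_norm X_separable S_bounded x mG.
  have mHx := translate_borel ip_norm X_separable S_bounded x mH.
  have IF : nu.-integrable setT (fun y : borel X => (`|F (S x + (y : X))%R|)%:E).
    apply/integrableP; split.
      by apply/measurable_EFinP; exact: norm_measurable.
    by under eq_integral do rewrite gee0_abs ?lee_fin//.
  have IG : nu.-integrable setT (fun y : borel X => (`|G (S x + (y : X))%R|)%:E).
    apply/integrableP; split.
      by apply/measurable_EFinP; exact: norm_measurable.
    by under eq_integral do rewrite gee0_abs ?lee_fin//.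
  have Hx : (mean_norm S nu (fun y => a *: F y + G y)%R x < +oo)%E.
    have /integrableP[_] := integrableD measurableT (integrableZl measurableT `|a| IF) IG.
    apply: le_lt_trans; apply: ge0_le_integral => //.
    + by apply/measurable_EFinP; exact: norm_measurable.
    + apply: measurableT_comp => //.
      apply: emeasurable_funD; last by apply/measurable_EFinP; exact: norm_measurable.
      by apply: emeasurable_funM => //; apply/measurable_EFinP; exact: norm_measurable.
    + move=> y _; rewrite -EFinM -EFinD abse_EFin lee_fin.
      by rewrite (le_trans (ler_normD _ _))// normrZ ler_norm.
  apply: (ip_inj ip_norm) => h.
  have := vector_transition_ip h x mH; rewrite Hx => EH.
  have := vector_transition_ip h x mF; rewrite Fx => EF.
  have := vector_transition_ip h x mG; rewrite Gx => EG.
  apply: (etrans EH); apply/esym; rewrite (ipDl ip) (ipZl ip).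
  apply: (etrans (congr2 (fun u v => a * u + v) EF EG)); apply/esym.
  have IFh := integrable_ip ip_norm h mFx IF.
  have IGh := integrable_ip ip_norm h mGx IG.
  rewrite /Pscalar -RintegralZl// -RintegralD//.
    by apply: eq_Rintegral => y _; rewrite (ipDl ip) (ipZl ip).
  exact: (integrableZl measurableT a IFh).
- by exists 1 => f Lf; rewrite mul1e; exact: contr.
- move=> F CF; apply: aeW => x.
  by rewrite /vector_transition Cb_mean_norm_lty.
Qed.

(** Pairing with h reduces the identity to the scalar one for <F, h>. *)
Lemma vector_transition_integral (F : X -> X) : Lp_vector m1 p F ->
  bochner m0 (vector_transition F) = bochner m1 F.
Proof.
move=> LF; have [mF fF] := LF.
have mN : mnorm F by exact: (@norm_measurable R X _ (borel X) F).
have IF : m1.-integrable setT (fun x => (`|F x|)%:E) by exact: Lp_norm_integrable fF.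
have [ext _] := vector_extension.
have [mTF fTF] := ext_Lp ext LF.
have ITF : m0.-integrable setT (fun x => (`|vector_transition F x|)%:E).
  apply: (Lp_norm_integrable p1 _ fTF).
  exact: (@norm_measurable R X _ (borel X) (vector_transition F)).
apply: (ip_inj ip_norm) => h.
rewrite (@ip_bochner R X ip ip_norm X_separable _ (borel X) m0 _ h mTF ITF).
rewrite (@ip_bochner R X ip ip_norm X_separable _ (borel X) m1 _ h mF IF).
have IFh := @integrable_ip R X ip ip_norm _ (borel X) m1 F h mF IF.
have mFh := @ip_measurable R X ip ip_norm _ (borel X) F h mF.
rewrite -(Pscalar_integral ip_norm X_separable S_bounded m1_image IFh).
congr fine; apply: ae_eq_integral => //.
- apply/measurable_EFinP; exact: (@ip_measurable R X ip ip_norm _ (borel X) _ h mTF).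
- apply/measurable_EFinP; apply: (Pscalar_measurable ip_norm X_separable S_bounded).
  exact: mFh.
have := ae_mean_norm_lty ip_norm X_separable S_bounded m1_image mN IF.
apply: (@filterS _ _ (ae_filter_ringOfSetsType m0)) => x Fx _.
by rewrite vector_transition_ip// Fx.
Qed.

End Extensions.

Unset Implicit Arguments.

Theorem proposition21 (R : realType) (X : completeNormedModType R)
  (ip : {dot X for @idfun R})
  (ip_norm : forall x : X, ip x x = `|x| ^+ 2)
  (X_separable : separable X)
  (D : R -> set X) (A : R -> X -> X) (U : R -> R -> X -> X)
  (U_evolution : evolution_operator D A U)
  (U_growth : growth_exponents U !=set0)
  (U_stable : (omega0 U < 0)%E)
  (B : R -> X -> X)
  (B_operator : forall t, bounded_operator (B t))
  (B_bounded : exists K : R, forall t, (opnorm (B t) <= K%:E)%E)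
  (B_measurable : forall x : X,
     measurable_fun [set: R] ((fun t => B t x) : R -> borel X))
  (Q_trace_class : forall s t, s <= t -> trace_class ip (Qts ip U B t s))
  (Q_trace_bounded : forall t : R,
     (ereal_sup [set trace ip (Qts ip U B t s) | s in [set s | (s <= t)%R]]
        < +oo)%E)
  (controllability : forall s t, s < t ->
     range (U t s) `<=` range (sqrt_operator ip (Qts ip U B t s)))
  (N : R -> R -> probability (borel X) R)
  (N_gaussian : forall s t, s <= t ->
     is_gaussian ip (N t s) 0 (Qts ip U B t s))
  (mu : R -> probability (borel X) R)
  (mu_gaussian : forall t, is_gaussian ip (mu t) 0 (Qinf ip U B t)) :
  forall (s t p : R), s < t -> 1 <= p ->
  (exists T : (X -> R) -> (X -> R),
     [/\ bounded_extension (mu t) (mu s) p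
           (Lp_scalar (mu t) p) (Lp_scalar (mu s) p)
           (Pscalar (U t s) (N t s)) T,
         contraction_Lp (mu t) (mu s) p (Lp_scalar (mu t) p) T
       & forall phi, Lp_scalar (mu t) p phi ->
           \int[mu s]_x T phi x = \int[mu t]_x phi x]) /\
  (exists T : (X -> X) -> (X -> X),
     [/\ bounded_extension (mu t) (mu s) p
           (Lp_vector (mu t) p) (Lp_vector (mu s) p)
           (Pvector (U t s) (N t s)) T,
         contraction_Lp (mu t) (mu s) p (Lp_vector (mu t) p) T
       & forall Phi, Lp_vector (mu t) p Phi ->
           bochner (mu s) (T Phi) = bochner (mu t) Phi]).
Proof.
move=> s t p st p1.
have stle := ltW st.
have Ub := evo_bounded U_evolution stle.
have image : forall A, measurable A ->
    mu t A = (mu s \x N t s)%E (affine_map (U t s) @^-1` A).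
  apply: (gaussian_image ip_norm X_separable Ub (N_gaussian s t stle)
    (mu_gaussian s) (mu_gaussian t)).
  - move=> h; apply: (covariance_ge0 ip_norm X_separable U_evolution U_stable
      B_operator B_bounded B_measurable (t := s)); [exact: measurable_itv|by []].
  - move=> h; apply: (covariance_ge0 ip_norm X_separable U_evolution U_stable
      B_operator B_bounded B_measurable (t := t)); first exact: measurable_itv.
    by move=> r /=; rewrite !in_itv/= => /andP[].
  - move=> h; exact: (covariance_split ip_norm X_separable U_evolution U_stable
      B_operator B_bounded B_measurable h stle).
split.
  have [ext contr] := Pscalar_extension ip_norm X_separable Ub image p1.
  exists (Pscalar (U t s) (N t s)); split => // phi /Lp_scalarP[mphi phifin].
  apply: (Pscalar_integral ip_norm X_separable Ub image).
  have mn : measurable_fun setT (fun x : borel X => `|phi x|).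
    by apply: (measurableT_comp _ mphi).
  have := Lp_norm_integrable p1 mn phifin; apply: le_integrable => //.
    exact/measurable_EFinP.
  by move=> x _; rewrite !abse_EFin normr_id.
have [ext contr] := vector_extension ip_norm X_separable Ub image p1.
exists (vector_transition (U t s) (N t s)); split => // Phi.
exact: (vector_transition_integral ip_norm X_separable Ub image p1).
Qed.
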